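(* Let $E$ be a row-finite graph with a fixed choice of special edges. Let $R$ be a complete set of representatives of the $\sim_\infty$-equivalence classes of $X^\infty$ and $S$ a complete set of representatives of the $\sim_c$-equivalence classes of $X^c$. Then $\{(F_v,\phi_v),(F_x,\phi_x),(F_y,\phi_y)\mid v\in E^0,\ x\in R,\ y\in S\}$ is a complete set of representatives (each isomorphism class represented exactly once) for the isomorphism classes of nonempty connected extended representation graphs for $E$.
   Context: $E=(E^0,E^1,s,r)$ is a row-finite directed graph; a vertex is regular if it emits an edge; for each regular $v$ a fixed edge $e^v\in s^{-1}(v)$ is called special, all other edges nonspecial. Paths of length $n\ge1$ are words $y_1\dots y_n$ of edges with $r(y_i)=s(y_{i+1})$; paths of length $0$ are vertices ($s(v)=r(v)=v$). The double graph $E_d$ has vertices $E^0$ and edges $e$ (real) and $e^*$ (ghost) for $e\in E^1$, with $s_d(e)=s(e),r_d(e)=r(e),s_d(e^* )=r(e),r_d(e^* )=s(e)$. For $p=e_1\dots e_n$ set $p^*=e_n^*\dots e_1^*$. The set $X$ of (finite) basis paths consists of the paths in $E_d$: vertices; $p,p^*$ for paths $p$ of length $\ge1$ in $E$; $pq^*$ with $p=e_1\dots e_k,q=f_1\dots f_n$ of length $\ge1$ in $E$, $r(p)=r(q)$, and $e_k\ne f_n$ or $e_k=f_n$ nonspecial. $X_v=\{x\in X: s_d(x)=v\}$. $X^\infty$: left-infinite words $x=\dots x_3x_2x_1$ of edges of $E_d$ such that each $x_n\dots x_1$ is a basis path. $x\sim_\infty z$ iff there are $m,n\ge0$ with $\dots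 x_{m+2}x_{m+1}=\dots z_{n+2}z_{n+1}$. $X^c$: closed paths of length $\ge1$ in $E_d$ consisting only of real edges or only of ghost edges (equivalently finite basis paths $x$ with $x^2$ a basis path). $x_1\dots x_m\sim_c y_1\dots y_n$ iff $x_1\dots x_m=y_{k+1}\dots y_ny_1\dots y_k$ for some $1\le k\le n$. An extended representation graph for $E$ is a pair $(F,\phi)$, $F$ a directed graph, $\phi:F\to E_d$ a graph homomorphism, such that for every $w\in F^0$: (i) $w$ is a source or receives exactly one edge $f_w$; (ii) if $w$ is a source or $\phi(f_w)$ is a nonspecial real edge, $\phi$ maps $s^{-1}(w)$ bijectively onto $s_d^{-1}(\phi(w))$; (iii) if $\phi(f_w)$ is a special real edge, $\phi$ maps $s^{-1}(w)$ bijectively onto $s_d^{-1}(\phi(w))\setminus\{\phi(f_w)^*\}$; (iv) if $\phi(f_w)$ is a ghost edge, $\phi$ maps $s^{-1}(w)$ bijectively onto the ghost edges in $s_d^{-1}(\phi(w))$. An isomorphism $(F,\phi)\to(G,\psi)$ is a graph isomorphism $\alpha$ with $\psi\circ\alpha=\phi$. $F$ is connected if any two vertices are joined by a path when edge directions are ignored; nonempty if $F^0\ne\emptyset$. $(F_v,\phi_v)$ for $v\in E^0$: vertices $w_x$ ($x\in X_v$), edges $f_x$ ($x\in X_v\setminus\{v\}$) from $w_{x'}$ to $w_x$ where $x'$ is $x$ with its last edge removed ($x'=v$ if $|x|=1$); $\phi_v(w_x)=r_d(x)$, $\phi_v(f_x)=$ last edge of $x$. $(F_x,\phi_x)$ for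 $x=\dots x_2x_1\in X^\infty$: for $i\in\mathbb N$, $X_i$ = basis paths $y=y_1\dots y_n$, $n\ge1$, with $x_iy_1$ a basis path and $y_1\ne x_{i-1}$ if $i\ge2$. Vertices $w_i$ ($i\in\mathbb N$), $w_{i,y}$ ($y\in X_i$); edges $f_i$ from $w_{i+1}$ to $w_i$, and $f_{i,y}$ to $w_{i,y}$ from $w_i$ if $|y|=1$, from $w_{i,y_1\dots y_{n-1}}$ if $n\ge2$; $\phi_x(w_i)=r_d(x_i)$, $\phi_x(w_{i,y})=r_d(y)$, $\phi_x(f_i)=x_i$, $\phi_x(f_{i,y})=$ last edge of $y$. $(F_x,\phi_x)$ for $x=x_1\dots x_m\in X^c$: for $1\le i\le m$, $X_i$ = basis paths $y=y_1\dots y_n$, $n\ge1$, with $x_iy_1$ a basis path and $y_1\ne x_{i+1}$ ($x_{m+1}=x_1$). Vertices $w_i$ ($1\le i\le m$), $w_{i,y}$ ($y\in X_i$); edges $f_i$ from $w_{i-1}$ to $w_i$ ($w_0=w_m$), and $f_{i,y}$ as before; $\phi_x$ defined by the same formulas. *)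

(* Defs.v *)
From Stdlib Require Import List Arith Lia Relations.
Import ListNotations.
Set Implicit Arguments.

Record Egraph := {
  EV : Type;
  EE : Type;
  esrc : EE -> EV;
  erng : EE -> EV;
  special : EE -> Prop
}.

Definition row_finite (E : Egraph) : Prop :=
  forall v : EV E, exists l : list (EE E), forall e, esrc E e = v -> In e l.

Definition special_choice (E : Egraph) : Prop :=
  forall v : EV E, (exists e, esrc E e = v) ->
    exists e, (esrc E e = v /\ special E e) /\
      forall e', esrc E e' = v /\ special E e' -> e' = e.

Inductive dedge (A : Type) : Type := Real (e : A) | Ghost (e : A).
Arguments Real {A} e.
Arguments Ghost {A} e.

Record dgraph := { gV : Type; gE : Type; gsrc : gE -> gV; grng : gE -> gV }.
Arguments gsrc {d} _.
Arguments grng {d} _.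

Section WithE.
Variable E : Egraph.
Notation V := (EV E).
Notation Ed := (EE E).
Notation s := (esrc E).
Notation r := (erng E).
Notation D := (dedge Ed).

Definition sd (d : D) : V := match d with Real e => s e | Ghost e => r e end.
Definition rd (d : D) : V := match d with Real e => r e | Ghost e => s e end.

Fixpoint epath (p : list Ed) : Prop :=
  match p with
  | [] => True
  | e :: p' => match p' with [] => True | e' :: _ => r e = s e' /\ epath p' end
  end.

Fixpoint dpath (p : list D) : Prop :=
  match p with
  | [] => True
  | d :: p' => match p' with [] => True | d' :: _ => rd d = sd d' /\ dpath p' end
  end.

Definition star (q : list Ed) : list D := rev (map Ghost q).

Definition basis_word (w : list D) : Prop :=
  (exists p, p <> [] /\ epath p /\ w = map Real p) \/
  (exists q, q <> [] /\ epath q /\ w = star q) \/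
  (exists p0 e q0 f, epath (p0 ++ [e]) /\ epath (q0 ++ [f]) /\ r e = r f /\
      (e <> f \/ ~ special E e) /\ w = map Real (p0 ++ [e]) ++ star (q0 ++ [f])).

Lemma epath_app_l (l1 l2 : list Ed) : epath (l1 ++ l2) -> epath l1.
Proof.
  induction l1 as [|a l1 IH]; intros H; simpl; auto.
  destruct l1 as [|b l1]; simpl; auto.
  simpl in H. destruct H as [H1 H2]; split; auto. exact (IH H2).
Qed.

Lemma epath_tl (a : Ed) l : epath (a :: l) -> epath l.
Proof. destruct l; simpl; tauto. Qed.

Lemma removelast_map (A B : Type) (f : A -> B) (l : list A) :
  removelast (map f l) = map f (removelast l).
Proof.
  induction l as [|a l IH]; simpl; auto.
  destruct l; simpl in *; auto. rewrite IH; auto.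
Qed.

Lemma star_snoc q f : star (q ++ [f]) = Ghost f :: star q.
Proof. unfold star. rewrite map_app, rev_app_distr. reflexivity. Qed.

Lemma star_cons g q : star (g :: q) = star q ++ [Ghost g].
Proof. reflexivity. Qed.

Lemma basis_word_removelast (w : list D) :
  basis_word w -> removelast w <> [] -> basis_word (removelast w).
Proof.
  intros [[p [Hp [Hep ->]]] | [[q [Hq [Heq ->]]] | [p0 [e [q0 [f [H1 [H2 [H3 [H4 ->]]]]]]]]]] Hne.
  - left. rewrite removelast_map in *. exists (removelast p). split.
    + intro H; apply Hne; rewrite H; reflexivity.
    + split; auto. destruct p as [|a p']; [contradiction|].
      apply epath_app_l with (l2 := [last (a :: p') a]).
      rewrite <- app_removelast_last; auto.
  - destruct q as [|g q']; [contradiction|].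
    rewrite star_cons, removelast_last in *.
    right; left. exists q'. split.
    + intro H; apply Hne; rewrite H; reflexivity.
    + split; auto. exact (epath_tl _ _ Heq).
  - rewrite star_snoc. destruct q0 as [|g q1].
    + simpl. replace (map Real (p0 ++ [e]) ++ [@Ghost Ed f])
        with (map Real (p0 ++ [e]) ++ [@Ghost Ed f]) by reflexivity.
      rewrite removelast_last. left. exists (p0 ++ [e]). split; [|split; auto].
      destruct p0; discriminate.
    + rewrite star_cons.
      replace (map Real (p0 ++ [e]) ++ Ghost f :: star q1 ++ [Ghost g])
        with ((map Real (p0 ++ [e]) ++ Ghost f :: star q1) ++ [@Ghost Ed g])
        by (rewrite <- app_assoc; reflexivity).
      rewrite removelast_last. right; right.
      exists p0, e, q1, f. repeat split; auto.
      * exact (epath_tl _ _ H2).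
      * rewrite star_snoc; reflexivity.
Qed.

Lemma basis_removelast_cons (a : D) (l : list D) :
  basis_word (a :: l) -> l <> [] -> basis_word (a :: removelast l).
Proof.
  intros H Hl. destruct l as [|b l]; [contradiction|].
  change (a :: removelast (b :: l)) with (removelast (a :: b :: l)).
  apply basis_word_removelast; auto. simpl. destruct l; discriminate.
Qed.
End WithE.

Section ERG.
Variable E : Egraph.
Notation V := (EV E).
Notation Ed := (EE E).
Notation D := (dedge Ed).
Notation sd := (sd E).
Notation rd := (rd E).
Notation basis_word := (basis_word E).

Record ergraph := { F : dgraph; phiV : gV F -> V; phiE : gE F -> D }.

Definition out_bij (G : ergraph) (w : gV (F G)) (T : D -> Prop) : Prop :=
  (forall f1 f2, gsrc f1 = w -> gsrc f2 = w -> phiE G f1 = phiE G f2 -> f1 = f2) /\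
  (forall d, T d <-> exists f, gsrc f = w /\ phiE G f = d).

Definition is_ERG (G : ergraph) : Prop :=
  (forall f, sd (phiE G f) = phiV G (gsrc f) /\ rd (phiE G f) = phiV G (grng f)) /\
  (forall w : gV (F G), (forall f, grng f <> w) \/
             exists f, grng f = w /\ forall f', grng f' = w -> f' = f) /\
  (forall w, (forall f, grng f <> w) -> out_bij G w (fun d => sd d = phiV G w)) /\
  (forall f e, phiE G f = Real e -> ~ special E e ->
     out_bij G (grng f) (fun d => sd d = phiV G (grng f))) /\
  (forall f e, phiE G f = Real e -> special E e ->
     out_bij G (grng f) (fun d => sd d = phiV G (grng f) /\ d <> Ghost e)) /\
  (forall f e, phiE G f = Ghost e ->
     out_bij G (grng f) (fun d => sd d = phiV G (grng f) /\ exists e', d = Ghost e')).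

Definition erg_nonempty (G : ergraph) : Prop := inhabited (gV (F G)).

Definition gadj (G : dgraph) (u v : gV G) : Prop :=
  exists f, (gsrc f = u /\ grng f = v) \/ (gsrc f = v /\ grng f = u).

Definition erg_connected (G : ergraph) : Prop :=
  forall u v : gV (F G), clos_refl_trans _ (gadj (F G)) u v.

Definition erg_iso (G H : ergraph) : Prop :=
  exists (aV : gV (F G) -> gV (F H)) (aE : gE (F G) -> gE (F H))
         (bV : gV (F H) -> gV (F G)) (bE : gE (F H) -> gE (F G)),
    (forall x, bV (aV x) = x) /\ (forall y, aV (bV y) = y) /\
    (forall f, bE (aE f) = f) /\ (forall g, aE (bE g) = g) /\
    (forall f, gsrc (aE f) = aV (gsrc f)) /\ (forall f, grng (aE f) = aV (grng f)) /\
    (forall x, phiV H (aV x) = phiV G x) /\ (forall f, phiE H (aE f) = phiE G f).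

(* x : nat -> D encodes the left-infinite word ... x_3 x_2 x_1 with x_{k+1} = x k *)
Definition inXinf (x : nat -> D) : Prop :=
  forall n, 1 <= n -> basis_word (rev (map x (seq 0 n))).

Definition sim_inf (x z : nat -> D) : Prop :=
  exists m n, forall k, x (m + k) = z (n + k).

Definition inXc (x : list D) : Prop :=
  x <> [] /\ dpath E x /\ (exists a l, x = a :: l /\ sd a = rd (last l a)) /\
  ((forall d, In d x -> exists e, d = Real e) \/ (forall d, In d x -> exists e, d = Ghost e)).

Definition sim_c (x y : list D) : Prop :=
  exists k, 1 <= k <= length y /\ x = skipn k y ++ firstn k y.

(* X_v : the vertex v (encoded as []) and basis paths of length >= 1 with source v *)
Definition inXv (v : V) (w : list D) : Prop :=
  w = [] \/ (basis_word w /\ exists a l, w = a :: l /\ sd a = v).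

Lemma inXv_removelast v w : inXv v w -> inXv v (removelast w).
Proof.
  intros [->|[Hb [a [l [-> Ha]]]]]; [left; reflexivity|].
  destruct l as [|b l]; [left; reflexivity|].
  right. split.
  - apply basis_removelast_cons; auto. discriminate.
  - exists a, (removelast (b :: l)). split; auto.
Qed.

Definition rdw (v : V) (w : list D) : V :=
  match w with [] => v | a :: l => rd (last l a) end.

Definition Fv_graph (v : V) : dgraph := {|
  gV := {w : list D | inXv v w};
  gE := {p : D * list D | inXv v (fst p :: snd p)};
  gsrc := fun p => exist _ (removelast (fst (proj1_sig p) :: snd (proj1_sig p)))
                     (inXv_removelast (proj2_sig p));
  grng := fun p => exist _ (fst (proj1_sig p) :: snd (proj1_sig p)) (proj2_sig p) |}.

Definition Fv (v : V) : ergraph := {|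
  F := Fv_graph v;
  phiV := fun (w : {w : list D | inXv v w}) => rdw v (proj1_sig w);
  phiE := fun (p : {p : D * list D | inXv v (fst p :: snd p)}) =>
            last (snd (proj1_sig p)) (fst (proj1_sig p)) |}.

(* index i here stands for the paper's index i+1; y = a :: l *)
Definition inXi (x : nat -> D) (i : nat) (a : D) (l : list D) : Prop :=
  basis_word (a :: l) /\ basis_word [x i; a] /\ (1 <= i -> a <> x (i - 1)).

Lemma inXi_removelast x i a b l :
  inXi x i a (b :: l) -> inXi x i a (removelast (b :: l)).
Proof.
  intros [H1 H2]; split; auto.
  apply basis_removelast_cons; auto. discriminate.
Qed.

Definition Tinf (x : nat -> D) :=
  {t : nat * D * list D | inXi x (fst (fst t)) (snd (fst t)) (snd t)}.

Definition srcI (x : nat -> D) (i : nat) (a : D) (l : list D) :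
  inXi x i a l -> nat + Tinf x :=
  match l as l0 return inXi x i a l0 -> nat + Tinf x with
  | [] => fun _ => inl i
  | b :: l' => fun H => inr (exist _ (i, a, removelast (b :: l'))
                                 (inXi_removelast H))
  end.

Definition Finf_graph (x : nat -> D) : dgraph := {|
  gV := nat + Tinf x;
  gE := nat + Tinf x;
  gsrc := fun f => match f with
                   | inl i => inl (S i)
                   | inr t => srcI (proj2_sig t)
                   end;
  grng := fun f => f |}.

Definition Finf (x : nat -> D) : ergraph := {|
  F := Finf_graph x;
  phiV := fun (w : nat + Tinf x) => match w with
          | inl i => rd (x i)
          | inr t => rd (last (snd (proj1_sig t)) (snd (fst (proj1_sig t))))
          end;
  phiE := fun (f : nat + Tinf x) => match f with
          | inl i => x i
          | inr t => last (snd (proj1_sig t)) (snd (fst (proj1_sig t)))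
          end |}.

(* x = x_1 ... x_m is the list x with x_{i+1} = nth i x; index i < m stands for i+1 *)
Definition cnth (x : list D) (i : nat) : i < length x -> D :=
  match x as x0 return i < length x0 -> D with
  | [] => fun H => False_rect _ (Nat.nlt_0_r i H)
  | d :: t => fun _ => nth i (d :: t) d
  end.

Definition inXcy (x : list D) (i : nat) (a : D) (l : list D) : Prop :=
  basis_word (a :: l) /\
  (exists xi, nth_error x i = Some xi /\ basis_word [xi; a]) /\
  nth_error x (S i mod length x) <> Some a.

Lemma inXcy_removelast x i a b l :
  inXcy x i a (b :: l) -> inXcy x i a (removelast (b :: l)).
Proof.
  intros [H1 H2]; split; auto.
  apply basis_removelast_cons; auto. discriminate.
Qed.

Definition Idx (x : list D) := {i : nat | i < length x}.

Definition Tcyc (x : list D) :=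
  {t : nat * D * list D |
    fst (fst t) < length x /\ inXcy x (fst (fst t)) (snd (fst t)) (snd t)}.

Lemma cpred_lt (m i : nat) :
  i < m -> (match i with 0 => m - 1 | S j => j end) < m.
Proof. destruct i; lia. Qed.

Definition cpred (x : list D) (i : Idx x) : Idx x :=
  exist _ (match proj1_sig i with 0 => length x - 1 | S j => j end)
        (cpred_lt (proj2_sig i)).

Definition srcC (x : list D) (i : nat) (a : D) (l : list D) :
  i < length x /\ inXcy x i a l -> Idx x + Tcyc x :=
  match l as l0 return i < length x /\ inXcy x i a l0 -> Idx x + Tcyc x with
  | [] => fun H => inl (exist _ i (proj1 H))
  | b :: l' => fun H => inr (exist _ (i, a, removelast (b :: l'))
                           (conj (proj1 H) (inXcy_removelast (proj2 H))))
  end.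

Definition Fcyc_graph (x : list D) : dgraph := {|
  gV := Idx x + Tcyc x;
  gE := Idx x + Tcyc x;
  gsrc := fun f => match f with
                   | inl i => inl (cpred i)
                   | inr t => srcC (proj2_sig t)
                   end;
  grng := fun f => f |}.

Definition Fcyc (x : list D) : ergraph := {|
  F := Fcyc_graph x;
  phiV := fun (w : Idx x + Tcyc x) => match w with
          | inl i => rd (@cnth x (proj1_sig i) (proj2_sig i))
          | inr t => rd (last (snd (proj1_sig t)) (snd (fst (proj1_sig t))))
          end;
  phiE := fun (f : Idx x + Tcyc x) => match f with
          | inl i => @cnth x (proj1_sig i) (proj2_sig i)
          | inr t => last (snd (proj1_sig t)) (snd (fst (proj1_sig t)))
          end |}.

Inductive fidx : Type :=
  | FVert (v : V)
  | FInf (x : nat -> D)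
  | FCyc (y : list D).

Definition Fam (i : fidx) : ergraph :=
  match i with FVert v => Fv v | FInf x => Finf x | FCyc y => Fcyc y end.

End ERG.

Definition complete_reps (T : Type) (P : T -> Prop) (eqv : T -> T -> Prop)
  (Rep : T -> Prop) : Prop :=
  (forall x, Rep x -> P x) /\
  (forall x, P x -> exists z, Rep z /\ eqv x z) /\
  (forall x z, Rep x -> Rep z -> eqv x z -> x = z).

(* Main.v *)
(* Whether a word is a basis path depends only on its pairs of consecutive letters, and the axioms
   (ii)-(iv) say precisely that the edges leaving the range of an edge [f] carry, once each, the
   letters that may follow the label of [f]. Hence a connected extended representation graph is
   determined by the ancestors of any of its vertices, which leaves three cases: there is a source;
   some vertex has an infinite, never repeating line of ancestors, whose labels spell an element
   of X^infinity; or the line of ancestors runs into a cycle, whose labels spell an element of X^c.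
   An isomorphism carries lines of ancestors to lines of ancestors with the same labels, and any two
   lines of ancestors in F_x eventually agree up to a shift. *)

Require Import Defs.
From Stdlib Require Import List Relations.
From Stdlib Require Import Sorted Lia Arith Classical ClassicalEpsilon ProofIrrelevance.
Import ListNotations.

(** * Basis paths *)

(** The vertices of an abstract graph carry no normal form, so an isomorphism is grown rather than
    written down. A partial matching [Q] of ancestor-closed vertex sets is fixed, and [spread]
    extends it along equally labelled edges. At most one edge enters a vertex, so a matched pair can
    be traced back in only one way: the grown relation is injective both ways. Connectedness makes
    it total, and choice turns it into maps. Every isomorphism onto a member of the family comes
    from [iso_of_core]; only [Q] varies. For lines of ancestors, equal labels do not suffice: a
    cycle and the infinite line that unrolls it have the same labels. Hence the two lines must also
    repeat at the same indices. Repetition is counted in edges and not in letters, which keeps a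
    cyclic word that is a proper power apart from its root. *)

Lemma sig_ext {A : Type} (P : A -> Prop) (u v : {a | P a}) :
  proj1_sig u = proj1_sig v -> u = v.
Proof. apply eq_sig_hprop. intros; apply proof_irrelevance. Qed.

Lemma last_cons {A : Type} (a d : A) l : last (a :: l) d = last l a.
Proof.
  revert a d. induction l as [|b l IH]; intros a d; [reflexivity|].
  change (last (a :: b :: l) d) with (last (b :: l) d).
  rewrite (IH b d), (IH b a). reflexivity.
Qed.

Lemma snoc_cases {A : Type} (l : list A) : l = [] \/ exists l' b, l = l' ++ [b].
Proof. destruct l using rev_ind; eauto. Qed.

Lemma removelast_cons {A : Type} (a : A) l :
  l <> [] -> removelast (a :: l) = a :: removelast l.
Proof. destruct l; [contradiction|reflexivity]. Qed.

(** [Sorted] is built from the left, whereas the vertices of the model graphs grow by a letter on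
    the right; this translates between the two. *)
Lemma Sorted_snoc {A : Type} (R : A -> A -> Prop) a l b :
  Sorted R (a :: l ++ [b]) <-> Sorted R (a :: l) /\ R (last l a) b.
Proof.
  revert a. induction l as [|c l IH]; intros a.
  - simpl. split.
    + intros H. apply Sorted_inv in H as [_ H]. apply HdRel_inv in H. auto.
    + intros [_ H]. auto.
  - rewrite last_cons. simpl app. split.
    + intros H. apply Sorted_inv in H as [H H']. apply HdRel_inv in H'.
      apply IH in H as [H1 H2]. auto.
    + intros [H H2]. apply Sorted_inv in H as [H H']. apply HdRel_inv in H'.
      constructor; [apply IH; auto | auto].
Qed.

Lemma Sorted_nth {A : Type} (R : A -> A -> Prop) l d i :
  Sorted R l -> S i < length l -> R (nth i l d) (nth (S i) l d).
Proof.
  intros H. revert i. induction H as [|a l Hl IH Ha]; simpl; [lia|].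
  intros i Hi. destruct i as [|i].
  - destruct l; simpl in *; [lia|]. apply HdRel_inv in Ha. exact Ha.
  - apply IH. lia.
Qed.

Lemma Sorted_rev_seq {A : Type} (R : A -> A -> Prop) (x : nat -> A) n :
  (forall k, R (x (S k)) (x k)) -> Sorted R (rev (map x (seq 0 n))).
Proof.
  intros H. induction n as [|n IH]; [constructor|].
  rewrite seq_S, map_app, rev_app_distr. simpl. constructor; [exact IH|].
  destruct n as [|n]; [constructor|].
  rewrite seq_S, map_app, rev_app_distr. simpl. constructor. apply H.
Qed.

(** The basis paths of length two. The real-ghost case is the peak of $pq^*$, and the ghost-real
    case is empty because no basis path turns from ghost to real. *)
Definition step {E : Egraph} (d d' : dedge (EE E)) : Prop :=
  match d, d' with
  | Real e, Real e' => erng E e = esrc E e'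
  | Real e, Ghost f => erng E e = erng E f /\ (e <> f \/ ~ special E e)
  | Ghost e, Ghost f => esrc E e = erng E f
  | Ghost _, Real _ => False
  end.

Lemma step_rd_sd {E : Egraph} (d d' : dedge (EE E)) : step d d' -> rd E d = sd E d'.
Proof. destruct d, d'; simpl; tauto. Qed.

Lemma Sorted_map_Real {E : Egraph} p : epath E p -> Sorted step (map (@Real (EE E)) p).
Proof.
  induction p as [|e p IH]; simpl; [constructor|].
  destruct p; simpl; intros H; [repeat constructor|].
  destruct H; constructor; auto.
Qed.

Lemma Sorted_star {E : Egraph} q : epath E q -> Sorted step (star E q).
Proof.
  induction q as [|e q IH]; intros H; [constructor|].
  rewrite star_cons. destruct (snoc_cases q) as [->|(q' & f & ->)].
  - repeat constructor.
  - specialize (IH (epath_tl _ _ _ H)). rewrite star_snoc in *.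
    simpl app. apply Sorted_snoc. split; auto.
    destruct q' as [|g q'].
    + simpl. simpl in H. symmetry. tauto.
    + rewrite star_cons, last_last. simpl in *. symmetry. tauto.
Qed.

Lemma epath_snoc {E : Egraph} q f e :
  epath E (q ++ [f]) -> erng E f = esrc E e -> epath E ((q ++ [f]) ++ [e]).
Proof.
  induction q as [|g q IH]; simpl; [tauto|].
  destruct q; simpl in *; tauto.
Qed.

Lemma Sorted_app {A : Type} (R : A -> A -> Prop) l1 a b l2 :
  Sorted R (l1 ++ [a]) -> R a b -> Sorted R (b :: l2) -> Sorted R ((l1 ++ [a]) ++ b :: l2).
Proof.
  induction l1 as [|c l1 IH]; simpl; intros H1 H2 H3; [auto|].
  apply Sorted_inv in H1 as [H1 H1']. constructor; [auto|].
  destruct l1; simpl in *; apply HdRel_inv in H1'; auto.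
Qed.

(** From right to left a letter is prepended to one of the three shapes. Prepending a ghost edge to
    a ghost word appends to [q], because [star] reverses. A new shape arises only when a real edge
    meets a purely ghost word, and there [step] is exactly the condition on the peak. *)
Lemma basis_word_iff {E : Egraph} (w : list (dedge (EE E))) :
  basis_word E w <-> w <> [] /\ Sorted step w.
Proof.
  split.
  - intros [(p & Hp & Hep & ->)|[(q & Hq & Heq & ->)|(p0 & e & q0 & f & H1 & H2 & H3 & H4 & ->)]].
    + split; [destruct p; [contradiction|discriminate]|]. now apply Sorted_map_Real.
    + split; [|now apply Sorted_star].
      destruct q; [contradiction|]. rewrite star_cons.
      intros H; apply app_eq_nil in H as [_ H]; discriminate.
    + split; [destruct p0; discriminate|].
      apply Sorted_map_Real in H1. apply Sorted_star in H2.
      rewrite star_snoc in *. rewrite map_app in *. simpl map in *.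
      apply Sorted_app; auto. simpl; auto.
  - intros [Hne H]. induction w as [|a w IH]; [contradiction|].
    apply Sorted_inv in H as [H Ha].
    destruct w as [|b w].
    + destruct a as [e|e].
      * left. exists [e]. repeat split; discriminate.
      * right; left. exists [e]. repeat split; discriminate.
    + apply HdRel_inv in Ha.
      destruct (IH ltac:(discriminate) H) as
        [(p & Hp & Hep & Hw)|[(q & Hq & Heq & Hw)|(p0 & e & q0 & f & H1 & H2 & H3 & H4 & Hw)]].
      * destruct p as [|e' p]; [contradiction|]. injection Hw as -> ->.
        destruct a as [e|e]; [|contradiction].
        left. exists (e :: e' :: p). repeat split; auto; discriminate.
      * destruct (snoc_cases q) as [->|(q0 & f & ->)]; [contradiction|].
        rewrite star_snoc in Hw. injection Hw as -> ->.
        destruct a as [e|e]; simpl in Ha.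
        -- right; right. exists [], e, q0, f. rewrite star_snoc. simpl. tauto.
        -- right; left. exists ((q0 ++ [f]) ++ [e]).
           split; [destruct q0; discriminate|]. split; [now apply epath_snoc|].
           rewrite !star_snoc. reflexivity.
      * destruct a as [e'|e'].
        -- right; right. exists (e' :: p0), e, q0, f. repeat split; auto.
           ++ destruct p0 as [|c p0]; injection Hw as -> _; simpl in *; auto.
           ++ rewrite Hw. reflexivity.
        -- destruct p0 as [|c p0]; injection Hw as -> _; contradiction.
Qed.

Lemma basis_word_pair {E : Egraph} (a b : dedge (EE E)) : basis_word E [a; b] <-> step a b.
Proof.
  rewrite basis_word_iff. split.
  - intros [_ H]. apply Sorted_inv in H as [_ H]. now apply HdRel_inv in H.
  - intros H. split; [discriminate|]. auto.
Qed.

Lemma basis_word_cons {E : Egraph} (a : dedge (EE E)) l :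
  basis_word E (a :: l) <-> Sorted step (a :: l).
Proof. rewrite basis_word_iff. split; [tauto|]. split; [discriminate|auto]. Qed.

Lemma inXinf_iff {E : Egraph} (x : nat -> dedge (EE E)) :
  inXinf E x <-> forall n, step (x (S n)) (x n).
Proof.
  split.
  - intros H n. specialize (H (S (S n)) ltac:(lia)). apply basis_word_iff in H as [_ H].
    rewrite !seq_S, !map_app, !rev_app_distr in H. simpl in H.
    apply Sorted_inv in H as [_ H]. now apply HdRel_inv in H.
  - intros H n Hn. apply basis_word_iff. split; [|now apply Sorted_rev_seq].
    destruct n; [lia|]. rewrite seq_S, map_app, rev_app_distr. discriminate.
Qed.

(* A ghost edge is never followed by a real one, so a cyclic word whose consecutive pairs are basis
   paths is purely real or purely ghost. *)
Lemma inXc_iff {E : Egraph} (x : list (dedge (EE E))) :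
  inXc E x <-> exists a l, x = a :: l /\ Sorted step (a :: l) /\ step (last l a) a.
Proof.
  split.
  - intros (Hne & Hd & (a & l & -> & Ha) & Hh). exists a, l. split; [reflexivity|].
    assert (Hstep : forall d d', In d (a :: l) -> In d' (a :: l) -> rd E d = sd E d' -> step d d').
    { intros d d' Hi Hi' He. destruct Hh as [Hh|Hh];
        destruct (Hh _ Hi) as [e ->], (Hh _ Hi') as [e' ->]; exact He. }
    split.
    + clear Hh Ha Hne. revert a Hd Hstep. induction l as [|b l IH]; intros a Hd Hstep; [auto|].
      destruct Hd as [Hd1 Hd2]. constructor.
      * apply IH; auto. intros; apply Hstep; simpl; auto.
      * constructor. apply Hstep; simpl; auto.
    + apply Hstep; [|simpl; auto|now symmetry].
      destruct (snoc_cases l) as [->|(l' & b & ->)]; [simpl; auto|].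
      rewrite last_last. right. apply in_or_app. simpl; auto.
  - intros (a & l & -> & Hs & Hc). split; [discriminate|]. split; [|split].
    + clear Hc. revert a Hs. induction l as [|b l IH]; intros a Hs; [exact I|].
      apply Sorted_inv in Hs as [Hs Ha]. apply HdRel_inv in Ha. split; [|apply IH, Hs].
      now apply step_rd_sd.
    + exists a, l. split; [reflexivity|]. symmetry. now apply step_rd_sd.
    (* If the last letter is real, so is everything before it. If it is ghost, the closing pair
       makes the first letter ghost, and then everything after it. *)
    + destruct (last l a) as [e|e] eqn:Hl.
      * left. clear Hc. revert a Hs Hl. induction l as [|b l IH]; intros a Hs Hl d Hd.
        -- destruct Hd as [<-|[]]. simpl in Hl. eauto.
        -- apply Sorted_inv in Hs as [Hs Ha]. apply HdRel_inv in Ha.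
           rewrite last_cons in Hl. specialize (IH b Hs Hl). destruct Hd as [<-|Hd]; [|auto].
           destruct (IH b (or_introl eq_refl)) as [e' ->]. destruct a; [eauto|contradiction].
      * right. destruct a as [e'|e']; [contradiction|]. clear Hl Hc.
        revert e' Hs. induction l as [|b l IH]; intros e' Hs d [<-|Hd]; eauto.
        -- destruct Hd.
        -- apply Sorted_inv in Hs as [Hs Ha]. apply HdRel_inv in Ha.
           destruct b as [f|f]; [contradiction|]. eauto.
Qed.

Lemma out_bij_ext {E : Egraph} (G : ergraph E) w (T T' : dedge (EE E) -> Prop) :
  (forall d, T d <-> T' d) -> out_bij G w T -> out_bij G w T'.
Proof.
  intros H [H1 H2]. split; [exact H1|]. intros d. rewrite <- H. apply H2.
Qed.

Definition source {G : dgraph} (w : gV G) : Prop := forall f, grng f <> w.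

Lemma source_or_edge {G : dgraph} (w : gV G) : source w \/ exists f, grng f = w.
Proof.
  destruct (classic (exists f : gE G, grng f = w)) as [H|H]; [auto|].
  left. intros f Hf. eauto.
Qed.

(** The three cases on the label of the incoming edge merge into [step], since [rd] of that label is
    the image of the vertex. By excluded middle, condition (i) reduces to injectivity of [grng]. *)
Lemma is_ERG_iff {E : Egraph} (G : ergraph E) :
  is_ERG G <->
  (forall f, sd E (phiE G f) = phiV G (gsrc f) /\ rd E (phiE G f) = phiV G (grng f)) /\
  (forall f f' : gE (F G), grng f = grng f' -> f = f') /\
  (forall w, source w -> out_bij G w (fun d => sd E d = phiV G w)) /\
  (forall f, out_bij G (grng f) (step (phiE G f))).
Proof.
  assert (Hnonsp : (forall f, rd E (phiE G f) = phiV G (grng f)) ->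
    forall f e, phiE G f = Real e -> ~ special E e ->
    forall d, step (phiE G f) d <-> sd E d = phiV G (grng f)).
  { intros Hr f e He Hsp d. rewrite <- Hr, He. destruct d; simpl; intuition. }
  assert (Hspec : (forall f, rd E (phiE G f) = phiV G (grng f)) ->
    forall f e, phiE G f = Real e -> special E e ->
    forall d, step (phiE G f) d <-> sd E d = phiV G (grng f) /\ d <> Ghost e).
  { intros Hr f e He Hsp d. rewrite <- Hr, He. destruct d; simpl; intuition congruence. }
  assert (Hghost : (forall f, rd E (phiE G f) = phiV G (grng f)) ->
    forall f e, phiE G f = Ghost e ->
    forall d, step (phiE G f) d <-> sd E d = phiV G (grng f) /\ exists e', d = Ghost e').
  { intros Hr f e He d. rewrite <- Hr, He. destruct d as [e0|e0]; simpl.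
    - split; [tauto|]. intros [_ [e' He']]. discriminate.
    - split; [intros ->; eauto|]. intros [-> _]. reflexivity. }
  split.
  - intros (Hhom & Hin & Hs & Hn & Hsp & Hg).
    assert (Hr : forall f, rd E (phiE G f) = phiV G (grng f)) by apply Hhom.
    split; [exact Hhom|]. split; [|split; [exact Hs|]].
    + intros f f' Hf. destruct (Hin (grng f)) as [H|(g & _ & Hg')].
      * destruct (H f eq_refl).
      * rewrite (Hg' f), (Hg' f'); auto.
    + intros f. destruct (phiE G f) as [e|e] eqn:He; [destruct (classic (special E e)) as [H|H]|];
        rewrite <- He; eapply out_bij_ext.
      * intros d. symmetry. exact (Hspec Hr f e He H d).
      * exact (Hsp f e He H).
      * intros d. symmetry. exact (Hnonsp Hr f e He H d).
      * exact (Hn f e He H).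
      * intros d. symmetry. exact (Hghost Hr f e He d).
      * exact (Hg f e He).
  - intros (Hhom & Hin & Hs & Hout).
    assert (Hr : forall f, rd E (phiE G f) = phiV G (grng f)) by apply Hhom.
    split; [exact Hhom|]. split; [|split; [exact Hs|]; split; [|split]].
    + intros w. destruct (source_or_edge w) as [H|[f <-]]; [auto|].
      right. exists f. auto.
    + intros f e He H. eapply out_bij_ext; [exact (Hnonsp Hr f e He H)|auto].
    + intros f e He H. eapply out_bij_ext; [exact (Hspec Hr f e He H)|auto].
    + intros f e He. eapply out_bij_ext; [exact (Hghost Hr f e He)|auto].
Qed.

(** * Extending isomorphisms from a set of ancestors *)

Lemma gadj_sym (G : dgraph) (u v : gV G) : gadj G u v -> gadj G v u.
Proof. intros [f Hf]. exists f. tauto. Qed.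

Lemma connected_ind (G : dgraph) (P : gV G -> Prop) u :
  (forall v w, clos_refl_trans _ (gadj G) v w) -> P u ->
  (forall f, P (gsrc f) -> P (grng f)) -> (forall f, P (grng f) -> P (gsrc f)) ->
  forall v, P v.
Proof.
  intros Hc Hu Hf Hb v. specialize (Hc u v).
  apply clos_rt_rtn1 in Hc. induction Hc as [|y z Hyz _ IH]; [exact Hu|].
  destruct Hyz as [f [[<- <-]|[<- <-]]]; auto.
Qed.

Lemma connected_to {E : Egraph} (G : ergraph E) (u : gV (F G)) :
  (forall v, clos_refl_trans _ (gadj (F G)) u v) -> erg_connected G.
Proof.
  intros H v w. apply rt_trans with u; [|apply H].
  specialize (H v). induction H as [x y Hxy|x|x y z _ IH1 _ IH2].
  - apply rt_step. now apply gadj_sym.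
  - apply rt_refl.
  - eapply rt_trans; eauto.
Qed.

(** The intended graph of the isomorphism, as the least relation that contains [Q] and follows
    equally labelled edges. *)
Inductive spread {E : Egraph} {G H : ergraph E} (Q : gV (F G) -> gV (F H) -> Prop) :
  gV (F G) -> gV (F H) -> Prop :=
| spread_core a b : Q a b -> spread Q a b
| spread_step f g : spread Q (gsrc f) (gsrc g) -> phiE G f = phiE H g ->
    spread Q (grng f) (grng g).

(** [Q] is a partial bijection closed under passing to ancestors, so that a pair of [Q] can be
    entered only from [Q]. *)
Definition is_core {E : Egraph} {G H : ergraph E} (Q : gV (F G) -> gV (F H) -> Prop) : Prop :=
  (forall a b, Q a b -> (source a /\ source b /\ phiV G a = phiV H b) \/
     exists f g, grng f = a /\ grng g = b /\ phiE G f = phiE H g /\ Q (gsrc f) (gsrc g)) /\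
  (forall a b b', Q a b -> Q a b' -> b = b') /\
  (forall a a' b, Q a b -> Q a' b -> a = a').

Lemma is_core_flip {E : Egraph} {G H : ergraph E} (Q : gV (F G) -> gV (F H) -> Prop) :
  is_core Q -> is_core (fun b a => Q a b).
Proof.
  intros (H1 & H2 & H3). split; [|split; [intros; eapply H3; eauto | intros; eapply H2; eauto]].
  intros b a Hab. destruct (H1 a b Hab) as [(Ha & Hb & He)|(f & g & Hf & Hg & He & HQ)].
  - left; auto.
  - right. exists g, f. auto.
Qed.

Lemma spread_flip {E : Egraph} {G H : ergraph E} (Q : gV (F G) -> gV (F H) -> Prop) a b :
  spread Q a b -> spread (G := H) (H := G) (fun b a => Q a b) b a.
Proof. induction 1; [now constructor|]. apply spread_step; auto. Qed.

Lemma spread_back {E : Egraph} {G H : ergraph E} (Q : gV (F G) -> gV (F H) -> Prop) a b :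
  is_core Q -> spread Q a b -> (source a /\ source b /\ phiV G a = phiV H b) \/
    exists f g, grng f = a /\ grng g = b /\ phiE G f = phiE H g /\ spread Q (gsrc f) (gsrc g).
Proof.
  intros (H1 & _) Hab. destruct Hab as [a b Hab|f g Hs He].
  - destruct (H1 a b Hab) as [?|(f & g & ?)]; [auto|].
    right. exists f, g. intuition. now constructor.
  - right. exists f, g. auto.
Qed.

Lemma ERG_in {E : Egraph} (G : ergraph E) (f f' : gE (F G)) :
  is_ERG G -> grng f = grng f' -> f = f'.
Proof. intros (_ & H & _)%is_ERG_iff. apply H. Qed.

Lemma ERG_out {E : Egraph} (G : ergraph E) (f f' : gE (F G)) :
  is_ERG G -> gsrc f = gsrc f' -> phiE G f = phiE G f' -> f = f'.
Proof.
  intros (_ & _ & Hs & Ho)%is_ERG_iff Hf.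
  destruct (source_or_edge (gsrc f')) as [H|[g Hg]].
  - destruct (Hs _ H) as [Hi _]. auto.
  - destruct (Ho g) as [Hi _]. apply Hi; congruence.
Qed.

(** A core vertex might also be reached by a growing step, for instance around a cycle. Its only
    incoming edge starts in the core, so by induction that step merely reproduces the partner that
    [Q] already gives. *)
Lemma spread_core_inj {E : Egraph} {G H : ergraph E} (Q : gV (F G) -> gV (F H) -> Prop) a b b' :
  is_ERG G -> is_ERG H -> is_core Q -> Q a b -> spread Q a b' -> b = b'.
Proof.
  intros HG HH (H1 & H2 & _) Hab Hs. revert b Hab.
  induction Hs as [a b' Hab'|f g Hs IH He]; intros b Hab; [eauto|].
  destruct (H1 _ _ Hab) as [(Ha & _)|(f' & g' & Hf & <- & He' & HQ)].
  - destruct (Ha f eq_refl).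
  - apply ERG_in in Hf; [|exact HG]. subst f'.
    f_equal. apply ERG_out; [exact HH| |congruence]. auto.
Qed.

Lemma spread_inj {E : Egraph} {G H : ergraph E} (Q : gV (F G) -> gV (F H) -> Prop) a b b' :
  is_ERG G -> is_ERG H -> is_core Q -> spread Q a b -> spread Q a b' -> b = b'.
Proof.
  intros HG HH HQ Hs. revert b'.
  induction Hs as [a b Hab|f g Hs IH He]; intros b' Hs'.
  - apply (spread_core_inj Q a b b'); auto.
  - destruct (spread_back _ _ _ HQ Hs') as [(Ha & _)|(f' & g' & Hf & <- & He' & HQ')].
    + destruct (Ha f eq_refl).
    + apply ERG_in in Hf; [|exact HG]. subst f'.
      f_equal. apply ERG_out; [exact HH| |congruence]. auto.
Qed.

(** Matched vertices emit the same labels: either both are sources over one vertex of [E], or both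
    are entered under one label. Hence the matching extends forwards. Against an edge it extends
    because a matched pair remembers its predecessors. *)
Lemma spread_total {E : Egraph} {G H : ergraph E} (Q : gV (F G) -> gV (F H) -> Prop) a0 b0 :
  is_ERG G -> is_ERG H -> erg_connected G -> is_core Q -> Q a0 b0 ->
  forall a, exists b, spread Q a b.
Proof.
  intros HG HH Hc HQ H0. apply (connected_ind _ _ a0 Hc).
  - exists b0. now constructor.
  - intros f [b Hb].
    assert (Hg : exists g, gsrc g = b /\ phiE H g = phiE G f).
    { destruct (spread_back _ _ _ HQ Hb) as [(Ha & Hb' & He)|(f' & g' & Hf & <- & He & _)].
      - apply is_ERG_iff in HG as (Hhom & _). apply is_ERG_iff in HH as (_ & _ & Hs & _).
        apply (Hs _ Hb'). rewrite <- He. apply Hhom.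
      - apply is_ERG_iff in HG as (_ & _ & _ & Ho). apply is_ERG_iff in HH as (_ & _ & _ & Ho').
        apply Ho'. rewrite <- He. apply Ho. eauto. }
    destruct Hg as (g & <- & Hg). exists (grng g). now apply spread_step.
  - intros f [b Hb].
    destruct (spread_back _ _ _ HQ Hb) as [(Ha & _)|(f' & g' & Hf & _ & _ & Hs)].
    + destruct (Ha f eq_refl).
    + apply ERG_in in Hf; [|exact HG]. subst f'. eauto.
Qed.

Lemma spread_edge {E : Egraph} {G H : ergraph E} (Q : gV (F G) -> gV (F H) -> Prop) f g :
  is_ERG G -> is_ERG H -> is_core Q -> spread Q (grng f) (grng g) ->
  phiE G f = phiE H g /\ spread Q (gsrc f) (gsrc g).
Proof.
  intros HG HH HQ Hs.
  destruct (spread_back _ _ _ HQ Hs) as [(Ha & _)|(f' & g' & Hf & Hg & He & Hs')].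
  - destruct (Ha f eq_refl).
  - apply ERG_in in Hf; [|exact HG]. apply ERG_in in Hg; [|exact HH]. subst. auto.
Qed.

Lemma spread_edge_total {E : Egraph} {G H : ergraph E} (Q : gV (F G) -> gV (F H) -> Prop) a0 b0 :
  is_ERG G -> is_ERG H -> erg_connected G -> is_core Q -> Q a0 b0 ->
  forall f, exists g, spread Q (grng f) (grng g).
Proof.
  intros HG HH Hc HQ H0 f.
  destruct (spread_total Q _ _ HG HH Hc HQ H0 (grng f)) as [b Hb].
  destruct (spread_back _ _ _ HQ Hb) as [(Ha & _)|(f' & g' & Hf & Hg & _)].
  - destruct (Ha f eq_refl).
  - exists g'. now rewrite Hg.
Qed.

(** The maps in the two directions are chosen independently, the second from the flipped core;
    uniqueness of partners makes them mutually inverse and compatible with sources and ranges. *)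
Lemma iso_of_core {E : Egraph} {G H : ergraph E} (Q : gV (F G) -> gV (F H) -> Prop) a0 b0 :
  is_ERG G -> is_ERG H -> erg_connected G -> erg_connected H -> is_core Q -> Q a0 b0 ->
  erg_iso G H.
Proof.
  intros HG HH GC HC HQ H0.
  assert (HQ' := is_core_flip _ HQ).
  assert (Hinj : forall a b b', spread Q a b -> spread Q a b' -> b = b')
    by (intros; eapply (spread_inj Q); eauto).
  assert (Hinj' : forall a a' b, spread Q a b -> spread Q a' b -> a = a').
  { intros. eapply (spread_inj _ b a a' HH HG HQ'); now apply spread_flip. }
  pose (aV := fun a => constructive_indefinite_description _ (spread_total Q _ _ HG HH GC HQ H0 a)).
  pose (aE := fun f => constructive_indefinite_description _ (spread_edge_total Q _ _ HG HH GC HQ H0 f)).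
  pose (bV := fun b => constructive_indefinite_description _ (spread_total _ _ _ HH HG HC HQ' H0 b)).
  pose (bE := fun g => constructive_indefinite_description _ (spread_edge_total _ _ _ HH HG HC HQ' H0 g)).
  assert (HaV : forall a, spread Q a (proj1_sig (aV a))) by (intros; apply (proj2_sig (aV a))).
  assert (HaE : forall f, spread Q (grng f) (grng (proj1_sig (aE f)))) by (intros; apply (proj2_sig (aE f))).
  assert (HbV : forall b, spread Q (proj1_sig (bV b)) b)
    by (intros; apply spread_flip, (proj2_sig (bV b))).
  assert (HbE : forall g, spread Q (grng (proj1_sig (bE g))) (grng g))
    by (intros; apply spread_flip, (proj2_sig (bE g))).
  clearbody aV aE bV bE.
  exists (fun a => proj1_sig (aV a)), (fun f => proj1_sig (aE f)),
    (fun b => proj1_sig (bV b)), (fun g => proj1_sig (bE g)).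
  repeat split.
  - intros a. eauto.
  - intros b. eauto.
  (* Edges are matched through their ranges, and an edge is determined by its range. *)
  - intros f. apply ERG_in; eauto.
  - intros g. apply ERG_in; eauto.
  - intros f. apply (Hinj (gsrc f)); [|apply HaV]. now apply spread_edge.
  - intros f. apply (Hinj (grng f)); auto.
  - intros a. destruct (spread_back _ _ _ HQ (HaV a)) as [(_ & _ & He)|(f & g & <- & <- & He & _)];
      [auto|].
    apply is_ERG_iff in HG as (Gh & _). apply is_ERG_iff in HH as (Hh & _).
    rewrite <- (proj2 (Gh f)), <- (proj2 (Hh g)). congruence.
  - intros f. symmetry. now apply (spread_edge Q).
Qed.

Lemma iso_of_source {E : Egraph} {G H : ergraph E} (a : gV (F G)) (b : gV (F H)) :
  is_ERG G -> is_ERG H -> erg_connected G -> erg_connected H ->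
  source a -> source b -> phiV G a = phiV H b -> erg_iso G H.
Proof.
  intros HG HH GC HC Ha Hb He.
  apply (iso_of_core (fun a' b' => a' = a /\ b' = b) a b); auto.
  split; [|split; intuition congruence].
  intros a' b' [-> ->]. auto.
Qed.

(** * Lines of ancestors *)

(* An infinite path read against the direction of its edges. *)
Definition back_chain (G : dgraph) (c : nat -> gE G) : Prop :=
  forall n, gsrc (c n) = grng (c (S n)).

(** Ancestors are unique, so two lines that share an edge coincide from there on. *)
Lemma back_chain_eq {E : Egraph} (G : ergraph E) c d i j :
  is_ERG G -> back_chain (F G) c -> back_chain (F G) d -> c i = d j ->
  forall k, c (k + i) = d (k + j).
Proof.
  intros HG Hc Hd Hij k. induction k as [|k IH]; [exact Hij|].
  apply ERG_in; [exact HG|]. simpl. rewrite <- Hc, <- Hd, IH. reflexivity.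
Qed.

Lemma back_chain_exists (G : dgraph) f :
  (forall w : gV G, ~ source w) -> exists c, back_chain G c /\ c 0 = f.
Proof.
  intros H.
  assert (Hp : forall f : gE G, exists g, grng g = gsrc f).
  { intros g. destruct (source_or_edge (gsrc g)) as [Hs|Hs]; [destruct (H _ Hs)|exact Hs]. }
  pose (p := fun g => constructive_indefinite_description _ (Hp g)).
  exists (fun n => Nat.iter n (fun g => proj1_sig (p g)) f). split; [|reflexivity].
  intros n. simpl. symmetry. apply (proj2_sig (p _)).
Qed.

(** The core pairs the ranges at equal indices. It is ancestor-closed by passing from [n] to [S n],
    and the last hypothesis is what makes it a partial bijection. *)
Lemma iso_of_back_chains {E : Egraph} {G H : ergraph E} c d :
  is_ERG G -> is_ERG H -> erg_connected G -> erg_connected H ->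
  back_chain (F G) c -> back_chain (F H) d -> (forall n, phiE G (c n) = phiE H (d n)) ->
  (forall n k, c n = c k <-> d n = d k) -> erg_iso G H.
Proof.
  intros HG HH GC HC Hc Hd He Hcd.
  apply (iso_of_core (fun a b => exists n, a = grng (c n) /\ b = grng (d n))
           (grng (c 0)) (grng (d 0))); eauto.
  split; [|split].
  - intros a b (n & -> & ->). right. exists (c n), (d n). repeat split; auto.
    exists (S n). auto.
  - intros a b b' (n & -> & ->) (k & Hk & ->). f_equal. apply Hcd. now apply ERG_in.
  - intros a a' b (n & -> & ->) (k & -> & Hk). f_equal. apply Hcd. now apply ERG_in.
Qed.

Lemma iso_sym {E : Egraph} (G H : ergraph E) : erg_iso G H -> erg_iso H G.
Proof.
  intros (aV & aE & bV & bE & H1 & H2 & H3 & H4 & H5 & H6 & H7 & H8).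
  exists bV, bE, aV, aE. repeat split; auto.
  - intros f. rewrite <- (H4 f) at 2. rewrite H5, H1. reflexivity.
  - intros f. rewrite <- (H4 f) at 2. rewrite H6, H1. reflexivity.
  - intros y. rewrite <- (H2 y) at 2. auto.
  - intros f. rewrite <- (H4 f) at 2. auto.
Qed.

Lemma iso_source {E : Egraph} (G H : ergraph E) (a : gV (F G)) :
  erg_iso G H -> source a -> exists b : gV (F H), source b /\ phiV H b = phiV G a.
Proof.
  intros (aV & aE & bV & bE & H1 & H2 & H3 & H4 & H5 & H6 & H7 & H8) Ha.
  exists (aV a). split; [|auto]. intros g Hg.
  apply (Ha (bE g)). rewrite <- (H1 (grng (bE g))), <- H6, H4, Hg. auto.
Qed.

(** The last clause carries the repetition pattern across, hence both injectivity and periods. *)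
Lemma iso_back_chain {E : Egraph} (G H : ergraph E) c :
  erg_iso G H -> back_chain (F G) c ->
  exists d, back_chain (F H) d /\ (forall n, phiE H (d n) = phiE G (c n)) /\
    (forall n k, d n = d k <-> c n = c k).
Proof.
  intros (aV & aE & bV & bE & H1 & H2 & H3 & H4 & H5 & H6 & H7 & H8) Hc.
  exists (fun n => aE (c n)). split; [|split; [auto|]].
  - intros n. rewrite H5, H6, Hc. reflexivity.
  - intros n k. split; [|congruence]. intros He. rewrite <- (H3 (c n)), He. auto.
Qed.

Definition period {A : Type} (c : nat -> A) (p : nat) : Prop :=
  0 < p /\ c p = c 0 /\ forall n, 0 < n < p -> c n <> c 0.

Lemma period_unique {A : Type} (c : nat -> A) p q : period c p -> period c q -> p = q.
Proof.
  intros (Hp & Hp1 & Hp2) (Hq & Hq1 & Hq2).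
  destruct (lt_eq_lt_dec p q) as [[H|H]|H]; auto.
  - destruct (Hq2 p); auto.
  - destruct (Hp2 q); auto.
Qed.

Lemma period_exists {A : Type} (c : nat -> A) n : 0 < n -> c n = c 0 -> exists p, period c p.
Proof.
  induction n as [n IH] using lt_wf_ind. intros Hn Hc.
  destruct (classic (exists k, 0 < k < n /\ c k = c 0)) as [(k & Hk & Hck)|Hno].
  - apply (IH k); tauto.
  - exists n. split; [auto|]. split; [auto|]. intros k Hk Hck. eauto.
Qed.

(** One return to the initial edge forces periodicity, because the line is determined from any of
    its edges on. *)
Lemma back_chain_mod {E : Egraph} (G : ergraph E) c p n :
  is_ERG G -> back_chain (F G) c -> period c p -> c n = c (n mod p).
Proof.
  intros HG Hc (Hp & H0 & _).
  assert (Hper : forall k q, c (k + q * p) = c k).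
  { intros k q. induction q as [|q IH]; [f_equal; lia|].
    rewrite <- IH. replace (k + S q * p) with ((k + q * p) + p) by lia.
    rewrite (back_chain_eq G c c p 0 HG Hc Hc H0). f_equal. lia. }
  rewrite (Nat.div_mod n p) at 1 by lia.
  rewrite <- (Hper (n mod p) (n / p)). f_equal. lia.
Qed.

Lemma back_chain_eq_iff {E : Egraph} (G : ergraph E) c p n k :
  is_ERG G -> back_chain (F G) c -> period c p -> (c n = c k <-> n mod p = k mod p).
Proof.
  intros HG Hc Hp. rewrite (back_chain_mod G c p n), (back_chain_mod G c p k) by auto.
  split; [|congruence]. destruct Hp as (Hp & H0 & Hmin).
  assert (Hlt : forall i j, i < j < p -> c i <> c j).
  { intros i j Hij He.
    (* Minimality speaks only of returns to [c 0]. Following the coincidence [c i = c j] for [p - j]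
       more steps turns it into such a return, at the index [p - j + i], which is smaller than
       [p]. *)
    apply (Hmin (p - j + i)); [lia|].
    rewrite (back_chain_eq G c c i j HG Hc Hc He (p - j)). rewrite <- H0. f_equal. lia. }
  assert (Hn := Nat.mod_upper_bound n p). assert (Hk := Nat.mod_upper_bound k p).
  intros He. destruct (lt_eq_lt_dec (n mod p) (k mod p)) as [[H|H]|H]; auto.
  - destruct (Hlt (n mod p) (k mod p)); auto; lia.
  - destruct (Hlt (k mod p) (n mod p)); auto; lia.
Qed.

(* [c] runs backwards through a simple cycle of [G] whose labels, read forwards, spell [y]. *)
Definition cycle_word {E : Egraph} (G : ergraph E) (c : nat -> gE (F G)) (y : list (dedge (EE E))) :=
  period c (length y) /\ y = rev (map (fun n => phiE G (c n)) (seq 0 (length y))).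

Lemma cycle_word_exists {E : Egraph} (G : ergraph E) (c : nat -> gE (F G)) p :
  period c p -> cycle_word G c (rev (map (fun n => phiE G (c n)) (seq 0 p))).
Proof.
  intros Hp. unfold cycle_word.
  rewrite length_rev, length_map, length_seq. auto.
Qed.

Lemma cycle_word_unique {E : Egraph} (G : ergraph E) (c : nat -> gE (F G)) y z :
  cycle_word G c y -> cycle_word G c z -> y = z.
Proof.
  intros [Hy ->] [Hz ->]. rewrite (period_unique _ _ _ Hy Hz). reflexivity.
Qed.

(** A common word gives a common period, hence the same repetition pattern, and the labels need
    comparing over one period only. *)
Lemma iso_of_cycle_words {E : Egraph} {G H : ergraph E} c d y :
  is_ERG G -> is_ERG H -> erg_connected G -> erg_connected H ->
  back_chain (F G) c -> back_chain (F H) d -> cycle_word G c y -> cycle_word H d y ->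
  erg_iso G H.
Proof.
  intros HG HH GC HC Hc Hd [Hpc Hyc] [Hpd Hyd].
  apply (iso_of_back_chains c d); auto.
  - intros n.
    rewrite (back_chain_mod G c _ n HG Hc Hpc), (back_chain_mod H d _ n HH Hd Hpd).
    rewrite Hyd in Hyc at 1. apply rev_inj in Hyc.
    assert (Hn := Nat.mod_upper_bound n (length y)).
    destruct Hpc as [Hp _].
    symmetry. apply (ext_in_map Hyc). apply in_seq. lia.
  - intros n k. rewrite (back_chain_eq_iff G c _ n k HG Hc Hpc).
    rewrite (back_chain_eq_iff H d _ n k HH Hd Hpd). reflexivity.
Qed.

Lemma iso_cycle_word {E : Egraph} (G H : ergraph E) c y :
  erg_iso G H -> back_chain (F G) c -> cycle_word G c y ->
  exists d, back_chain (F H) d /\ cycle_word H d y.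
Proof.
  intros Hi Hc [(Hp & Hc0 & Hmin) Hy].
  destruct (iso_back_chain G H c Hi Hc) as (d & Hd & Hl & Heq).
  exists d. split; [exact Hd|]. split.
  - split; [exact Hp|]. split; [now apply Heq|].
    intros n Hn He. apply (Hmin n Hn). now apply Heq.
  - rewrite Hy at 1. f_equal. apply map_ext. auto.
Qed.

Lemma back_chain_step {E : Egraph} (G : ergraph E) c n :
  is_ERG G -> back_chain (F G) c -> step (phiE G (c (S n))) (phiE G (c n)).
Proof.
  intros (_ & _ & _ & Ho)%is_ERG_iff Hc. apply Ho. exists (c n). auto.
Qed.

(** The closing pair of [y] is an ordinary consecutive pair of the line: the last letter is the
    label of [c 0], which equals [c p] for the period [p], and the first is the label of the edge
    just before index [p]. *)
Lemma cycle_word_inXc {E : Egraph} (G : ergraph E) c y :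
  is_ERG G -> back_chain (F G) c -> cycle_word G c y -> inXc E y.
Proof.
  intros HG Hc [(Hp & Hp0 & _) Hy]. apply inXc_iff.
  assert (Hs : Sorted step y).
  { rewrite Hy. apply (Sorted_rev_seq step (fun n => phiE G (c n))).
    intros; now apply back_chain_step. }
  destruct y as [|a l]; [simpl in Hp; lia|].
  exists a, l. split; [reflexivity|]. split; [exact Hs|].
  rewrite <- (last_cons a a l).
  assert (Hlast : last (a :: l) a = phiE G (c 0)).
  { rewrite Hy at 1. simpl length. simpl seq. simpl map. simpl rev. now rewrite last_last. }
  rewrite Hlast, <- Hp0. simpl length in *.
  rewrite seq_S, map_app, rev_app_distr in Hy. injection Hy as -> _.
  now apply back_chain_step.
Qed.

(** * The graphs F_v *)

Lemma inXv_cons {E : Egraph} v (a : dedge (EE E)) l :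
  inXv E v (a :: l) <-> Sorted step (a :: l) /\ sd E a = v.
Proof.
  unfold inXv. rewrite basis_word_cons. split.
  - intros [H|(H & a' & l' & He & Hs)]; [discriminate|]. injection He as <- <-. auto.
  - intros [H Hs]. right. eauto 6.
Qed.

Lemma Fv_source {E : Egraph} v (w : gV (F (Fv E v))) : source w <-> proj1_sig w = [].
Proof.
  destruct w as [[|a l] Hw]; simpl; split; intros H; try reflexivity; [| |discriminate].
  - intros f Hf. apply (f_equal (@proj1_sig _ _)) in Hf. discriminate.
  - destruct (H (exist _ (a, l) Hw)). now apply sig_ext.
Qed.

(** An edge that leaves a word appends one letter to it, and that letter is its label. The two [Hin]
    assertions record this at the source and at a nonempty word. *)
Lemma Fv_ERG {E : Egraph} v : is_ERG (Fv E v).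
Proof.
  apply is_ERG_iff. split; [|split; [|split]].
  - intros [[a l] H]. simpl fst in *; simpl snd in *. split; [|reflexivity].
    destruct (proj1 (inXv_cons _ _ _) H) as [Hs Ha].
    change (sd E (last l a) = rdw E v (removelast (a :: l))).
    destruct (snoc_cases l) as [->|(l' & b & ->)]; [exact Ha|].
    rewrite last_last, removelast_cons, removelast_last by (destruct l'; discriminate).
    apply Sorted_snoc in Hs as [_ Hs]. simpl. symmetry. now apply step_rd_sd.
  - intros [[a l] H] [[b m] H'] He. apply (f_equal (@proj1_sig _ _)) in He. simpl in He.
    apply sig_ext. simpl. congruence.
  - intros w Hw. apply Fv_source in Hw. destruct w as [w Hx]. simpl in Hw. subst w.
    assert (Hin : forall f : gE (F (Fv E v)), gsrc f = exist _ [] Hx ->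
              snd (proj1_sig f) = [] /\ phiE (Fv E v) f = fst (proj1_sig f)).
    { intros [[a l] H] Hs. apply (f_equal (@proj1_sig _ _)) in Hs.
      destruct l; [auto|discriminate]. }
    split.
    + intros f1 f2 H1 H2 He. destruct (Hin f1 H1) as [E1 E2], (Hin f2 H2) as [E3 E4].
      apply sig_ext. destruct f1 as [[a l] ?], f2 as [[b m] ?]. simpl in *. congruence.
    + intros d. split.
      * intros Hd. simpl in Hd.
        assert (H : inXv E v [d]) by (apply inXv_cons; auto).
        exists (exist _ (d, []) H). split; [now apply sig_ext|reflexivity].
      * intros (f & Hf & <-). destruct (Hin f Hf) as [E1 E2]. rewrite E2.
        destruct f as [[a l] H]. simpl in *. subst. exact (proj2 (proj1 (inXv_cons _ _ _) H)).
  - intros [[a l] H]. simpl grng. simpl phiE.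
    assert (Hin : forall f : gE (F (Fv E v)), gsrc f = exist _ (a :: l) H ->
              proj1_sig f = (a, l ++ [phiE (Fv E v) f])).
    { intros [[b m] H'] Hs. apply (f_equal (@proj1_sig _ _)) in Hs. simpl in *.
      destruct (snoc_cases m) as [->|(m' & c & ->)]; [discriminate|].
      change (removelast (b :: m' ++ [c]) = a :: l) in Hs.
      rewrite removelast_cons, removelast_last in Hs by (destruct m'; discriminate).
      rewrite last_last. congruence. }
    split.
    + intros f1 f2 H1 H2 He. apply sig_ext. rewrite (Hin f1 H1), (Hin f2 H2). congruence.
    + intros d. split.
      * intros Hd. assert (H' := H). apply inXv_cons in H' as [Hs Ha].
        assert (H' : inXv E v (a :: l ++ [d])).
        { apply inXv_cons. split; [apply Sorted_snoc; auto|exact Ha]. }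
        exists (exist _ (a, l ++ [d]) H'). split; [|apply last_last].
        apply sig_ext. simpl fst; simpl snd. simpl gsrc. simpl proj1_sig.
        change (removelast (a :: l ++ [d]) = a :: l).
        rewrite removelast_cons, removelast_last by (destruct l; discriminate). reflexivity.
      * intros (f & Hf & He). apply Hin in Hf. destruct f as [[b m] H'].
        rewrite He in Hf. simpl in Hf. injection Hf as -> ->.
        destruct (proj1 (inXv_cons _ _ _) H') as [Hs _]. now apply Sorted_snoc in Hs.
Qed.

Lemma Fv_connected {E : Egraph} v : erg_connected (Fv E v).
Proof.
  assert (H0 : inXv E v []) by now left.
  apply (connected_to (Fv E v) (exist _ [] H0)).
  intros [w Hw]. induction w as [|b w IH] using rev_ind.
  - rewrite (proof_irrelevance _ Hw H0). apply rt_refl.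
  - assert (Hw' : inXv E v w).
    { rewrite <- (removelast_last w b). now apply inXv_removelast. }
    apply rt_trans with (exist _ w Hw'); [apply IH|]. apply rt_step.
    destruct (w ++ [b]) as [|a l] eqn:Hal; [destruct w; discriminate|].
    exists (exist _ (a, l) Hw). left. split; apply sig_ext; [|reflexivity].
    change (removelast (a :: l) = w). rewrite <- Hal. apply removelast_last.
Qed.

(** * The graphs F_x of infinite words *)

Lemma inXi_iff {E : Egraph} (x : nat -> dedge (EE E)) i a l :
  inXi E x i a l <-> Sorted step (a :: l) /\ step (x i) a /\ (1 <= i -> a <> x (i - 1)).
Proof. unfold inXi. now rewrite basis_word_cons, basis_word_pair. Qed.

Definition mkTinf {E : Egraph} {x} i a l (H : inXi E x i a l) : Tinf E x := exist _ (i, a, l) H.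

Lemma mkTinf_ext {E : Egraph} {x} i a l i' a' l' (H : inXi E x i a l) (H' : inXi E x i' a' l') :
  i = i' -> a = a' -> l = l' -> mkTinf i a l H = mkTinf i' a' l' H'.
Proof. intros -> -> ->. now apply sig_ext. Qed.

(** [srcI] inspects the word from the left and carries a proof along; the right-end form given here
    is what inductions on branches use. *)
Lemma srcI_cases {E : Egraph} x i a l (H : inXi E x i a l) :
  (l = [] /\ srcI H = inl i) \/
  exists l' b H', l = l' ++ [b] /\ srcI H = inr (mkTinf i a l' H').
Proof.
  destruct l as [|b l]; [left; auto|]. right.
  exists (removelast (b :: l)), (last (b :: l) b), (inXi_removelast H).
  split; [|reflexivity]. apply app_removelast_last. discriminate.
Qed.

Lemma Finf_not_source {E : Egraph} x (w : gV (F (Finf E x))) : ~ source w.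
Proof. intros H. exact (H w eq_refl). Qed.

Lemma Finf_ERG {E : Egraph} x : inXinf E x -> is_ERG (Finf E x).
Proof.
  intros Hx. rewrite inXinf_iff in Hx.
  apply is_ERG_iff. split; [|split; [|split]].
  - intros [i|[[[i a] l] H]]; (split; [|reflexivity]).
    + symmetry. apply step_rd_sd, Hx.
    + simpl in H |- *. destruct (srcI_cases x i a l H) as [[-> ->]|(l' & b & H' & -> & ->)].
      * symmetry. apply step_rd_sd. now apply inXi_iff in H.
      * rewrite last_last. symmetry. apply step_rd_sd. apply inXi_iff in H as [H _].
        now apply Sorted_snoc in H.
  - intros f f' Hf. exact Hf.
  - intros w Hw. destruct (Finf_not_source _ _ Hw).
  - intros [i|[[[i a] l] H]]; simpl grng; simpl phiE.
    (* Out of [inl i] lead the core edge with index [i - 1], present only for positive [i], and the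
       branches of one letter. *)
    + assert (Hin : forall f : gE (F (Finf E x)), gsrc f = inl i ->
        (exists j, f = inl j /\ i = S j) \/
        (exists H, f = inr (mkTinf i (phiE (Finf E x) f) [] H))).
      { intros [j|[[[j a] l] H]] Hs.
        - left. exists j. split; [reflexivity|]. simpl in Hs. congruence.
        - right. simpl in Hs, H. destruct (srcI_cases x j a l H) as [[-> Hj]|(l' & b & H' & -> & Hj)].
          + assert (j = i) by congruence. subst j. exists H. reflexivity.
          + change (srcI H = inl i) in Hs. rewrite Hj in Hs. discriminate. }
      split.
      * intros f1 f2 H1 H2 He.
        destruct (Hin f1 H1) as [(j1 & -> & E1)|(K1 & E1)],
                 (Hin f2 H2) as [(j2 & -> & E2)|(K2 & E2)].
        -- f_equal. lia.
        (* A core edge and a branch cannot share a label: [inXi] excludes the letter [x (i - 1)] for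
           exactly this reason. *)
        -- destruct (proj1 (inXi_iff _ _ _ _) K2) as (_ & _ & K). rewrite <- He, E1 in K. simpl in K.
           rewrite Nat.sub_0_r in K. destruct K; [lia|reflexivity].
        -- destruct (proj1 (inXi_iff _ _ _ _) K1) as (_ & _ & K). rewrite He, E2 in K. simpl in K.
           rewrite Nat.sub_0_r in K. destruct K; [lia|reflexivity].
        -- rewrite E1, E2. f_equal. apply mkTinf_ext; auto.
      * intros d. split.
        -- intros Hd. destruct (classic (1 <= i /\ d = x (i - 1))) as [[Hi ->]|Hi].
           ++ exists (inl (i - 1)). split; [|reflexivity]. simpl. f_equal. lia.
           ++ assert (H : inXi E x i d []) by (apply inXi_iff; repeat split; auto).
              exists (inr (mkTinf i d [] H)). split; reflexivity.
        -- intros (f & Hf & <-). destruct (Hin f Hf) as [(j & -> & ->)|(K & _)]; [apply Hx|].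
           apply inXi_iff in K. tauto.
    + assert (Hin : forall f : gE (F (Finf E x)), gsrc f = inr (mkTinf i a l H) ->
        exists H, f = inr (mkTinf i a (l ++ [phiE (Finf E x) f]) H)).
      { intros [j|[[[j b] m] K]] Hs; [discriminate|]. simpl in Hs, K.
        destruct (srcI_cases x j b m K) as [[-> Hj]|(l' & c & H' & -> & Hj)];
          change (srcI K = inr (mkTinf i a l H)) in Hs; rewrite Hj in Hs; [discriminate|].
        injection Hs as -> -> ->. simpl. rewrite last_last. exists K. reflexivity. }
      split.
      * intros f1 f2 H1 H2 He. destruct (Hin f1 H1) as [K1 ->], (Hin f2 H2) as [K2 ->].
        f_equal. apply mkTinf_ext; congruence.
      * intros d. split.
        -- intros Hd. assert (H' : inXi E x i a (l ++ [d])).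
           { apply inXi_iff. destruct (proj1 (inXi_iff _ _ _ _) H). rewrite Sorted_snoc. auto. }
           exists (inr (mkTinf i a (l ++ [d]) H')). split; [|apply last_last].
           simpl. destruct (srcI_cases x i a (l ++ [d]) H') as [[Hj _]|(l' & c & K & Hl & Hj)].
           ++ destruct l; discriminate.
           ++ rewrite Hj. apply app_inj_tail in Hl as [-> _]. f_equal. now apply mkTinf_ext.
        -- intros (f & Hf & <-). destruct (Hin f Hf) as [K _].
           apply inXi_iff in K as [K _]. now apply Sorted_snoc in K.
Qed.

Lemma Finf_core_connected {E : Egraph} x i :
  clos_refl_trans _ (gadj (F (Finf E x))) (inl 0) (inl i).
Proof.
  induction i as [|i IH]; [apply rt_refl|].
  eapply rt_trans; [exact IH|]. apply rt_step. exists (inl i). right. split; reflexivity.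
Qed.

Lemma Finf_connected {E : Egraph} x : erg_connected (Finf E x).
Proof.
  apply (connected_to (Finf E x) (inl 0)).
  intros [i|[[[i a] l] H]]; [apply Finf_core_connected|]. simpl in H.
  induction l as [|b l IH] using rev_ind.
  - apply rt_trans with (inl i); [apply Finf_core_connected|].
    apply rt_step. exists (inr (mkTinf i a [] H)). left. split; reflexivity.
  - assert (Hs := srcI_cases x i a (l ++ [b]) H).
    destruct Hs as [[Hl _]|(l' & c & H' & Hl & Hs)]; [destruct l; discriminate|].
    apply app_inj_tail in Hl as [<- _].
    apply rt_trans with (inr (mkTinf i a l H')); [apply IH|].
    apply rt_step. exists (inr (mkTinf i a (l ++ [b]) H)). left. split; [exact Hs|reflexivity].
Qed.

Lemma Finf_back_chain {E : Egraph} x : back_chain (F (Finf E x)) inl.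
Proof. intros n. reflexivity. Qed.

(** Each step back shortens the word of a branch, so the line reaches the core; from there it can
    only climb through the indices. *)
Lemma Finf_back_chain_core {E : Egraph} x c :
  back_chain (F (Finf E x)) c -> exists N M, forall k, c (N + k) = inl (M + k).
Proof.
  intros Hc.
  assert (H : exists N M, c N = inl M).
  { destruct (c 0) as [i|[[[i a] l] H]] eqn:H0; [eauto|]. simpl in H.
    generalize 0 H0. clear H0. revert H. induction l as [|b l IH] using rev_ind; intros H n Hn.
    - exists (S n), i. rewrite <- (Hc n : _ = c (S n)), Hn. reflexivity.
    - destruct (srcI_cases x i a (l ++ [b]) H) as [[Hl _]|(l' & d & H' & Hl & Hs)].
      + destruct l; discriminate.
      + apply app_inj_tail in Hl as [<- _]. apply (IH H' (S n)).
        rewrite <- (Hc n : _ = c (S n)), Hn. exact Hs. }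
  destruct H as (N & M & H). exists N, M. intros k. induction k as [|k IH].
  - rewrite !Nat.add_0_r. exact H.
  - rewrite !Nat.add_succ_r. rewrite <- (Hc (N + k) : _ = c (S (N + k))), IH. reflexivity.
Qed.

(** A coincidence persists further back, and there the core indices are all distinct. *)
Lemma Finf_back_chain_inj {E : Egraph} x c n k :
  inXinf E x -> back_chain (F (Finf E x)) c -> c n = c k -> n = k.
Proof.
  intros Hx Hc He. destruct (Finf_back_chain_core x c Hc) as (N & M & H).
  assert (Hnk := back_chain_eq _ c c n k (Finf_ERG x Hx) Hc Hc He N).
  rewrite !H in Hnk. injection Hnk. lia.
Qed.

(** * The graphs F_x of cyclic words *)

Definition lab {E : Egraph} {x} (i : Idx E x) : dedge (EE E) := cnth E x (proj2_sig i).

Lemma nth_error_lab {E : Egraph} {x} (i : Idx E x) : nth_error x (proj1_sig i) = Some (lab i).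
Proof.
  destruct i as [i Hi]. unfold lab. simpl. destruct x as [|d t]; [simpl in Hi; lia|].
  now apply nth_error_nth'.
Qed.

Lemma lab_nth {E : Egraph} {x} (i : Idx E x) d : lab i = nth (proj1_sig i) x d.
Proof. symmetry. apply nth_error_nth, nth_error_lab. Qed.

Lemma succ_mod i m : i < m -> S i mod m = if S i =? m then 0 else S i.
Proof.
  intros H. destruct (Nat.eqb_spec (S i) m) as [->|Hne]; [apply Nat.Div0.mod_same|].
  apply Nat.mod_small. lia.
Qed.

Lemma csucc_lt {E : Egraph} {x} (i : Idx E x) : S (proj1_sig i) mod length x < length x.
Proof. destruct i as [i Hi]. apply Nat.mod_upper_bound. lia. Qed.

Definition csucc {E : Egraph} {x} (i : Idx E x) : Idx E x :=
  exist (fun k => k < length x) _ (csucc_lt i).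

Lemma cpred_csucc {E : Egraph} {x} (i : Idx E x) : cpred (csucc i) = i.
Proof.
  apply sig_ext. destruct i as [i Hi]. simpl. rewrite succ_mod by exact Hi.
  destruct (Nat.eqb_spec (S i) (length x)); lia.
Qed.

Lemma csucc_cpred {E : Egraph} {x} (i : Idx E x) : csucc (cpred i) = i.
Proof.
  apply sig_ext. destruct i as [[|i] Hi]; simpl.
  - rewrite succ_mod by lia. destruct (Nat.eqb_spec (S (length x - 1)) (length x)); lia.
  - rewrite succ_mod by lia. destruct (Nat.eqb_spec (S i) (length x)); lia.
Qed.

Lemma inXc_step {E : Egraph} x (i : Idx E x) : inXc E x -> step (lab (cpred i)) (lab i).
Proof.
  intros (a & l & -> & Hs & Hc)%inXc_iff. rewrite !(lab_nth _ a).
  destruct i as [[|i] Hi].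
  - replace (proj1_sig (cpred _)) with (length l) by (simpl; lia).
    replace (nth (length l) (a :: l) a) with (last l a); [exact Hc|].
    rewrite <- (last_cons a a l). destruct (exists_last (l := a :: l)) as (l' & b & Hl); [discriminate|].
    assert (Hlen := f_equal (@length _) Hl). rewrite length_app in Hlen. simpl in Hlen.
    rewrite Hl, last_last, app_nth2 by lia.
    replace (length l - length l') with 0 by lia. reflexivity.
  - exact (Sorted_nth step (a :: l) a i Hs Hi).
Qed.

Lemma inXcy_iff {E : Egraph} {x} (i : Idx E x) a l :
  proj1_sig i < length x /\ inXcy E x (proj1_sig i) a l <->
  Sorted step (a :: l) /\ step (lab i) a /\ a <> lab (csucc i).
Proof.
  unfold inXcy. rewrite nth_error_lab.
  change (S (proj1_sig i) mod length x) with (proj1_sig (csucc i)).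
  rewrite nth_error_lab, basis_word_cons. split.
  - intros (_ & H1 & (xi & Hxi & H2) & H3). injection Hxi as <-.
    apply basis_word_pair in H2. repeat split; auto. congruence.
  - intros (H1 & H2 & H3). split; [apply proj2_sig|]. split; [exact H1|]. split; [|congruence].
    exists (lab i). split; [reflexivity|]. now apply basis_word_pair.
Qed.

Definition mkTcyc {E : Egraph} {x} (i : Idx E x) a l
  (H : proj1_sig i < length x /\ inXcy E x (proj1_sig i) a l) : Tcyc E x :=
  exist _ (proj1_sig i, a, l) H.

Lemma mkTcyc_ext {E : Egraph} {x} (i i' : Idx E x) a l a' l' H H' :
  i = i' -> a = a' -> l = l' -> mkTcyc i a l H = mkTcyc i' a' l' H'.
Proof. intros -> -> ->. now apply sig_ext. Qed.

Lemma Tcyc_cases {E : Egraph} x (t : Tcyc E x) : exists i a l H, t = mkTcyc i a l H.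
Proof.
  destruct t as [[[i a] l] H]. exists (exist _ i (proj1 H)), a, l, H. reflexivity.
Qed.

Lemma Fcyc_src_cases {E : Egraph} x (i : Idx E x) a l H :
  (l = [] /\ gsrc (inr (mkTcyc i a l H) : gE (F (Fcyc E x))) = inl i) \/
  exists l' b H', l = l' ++ [b] /\
    gsrc (inr (mkTcyc i a l H) : gE (F (Fcyc E x))) = inr (mkTcyc i a l' H').
Proof.
  destruct l as [|b l].
  - left. split; [reflexivity|]. simpl. f_equal. now apply sig_ext.
  - right.
    exists (removelast (b :: l)), (last (b :: l) b), (conj (proj1 H) (inXcy_removelast (proj2 H))).
    split; [|reflexivity]. apply app_removelast_last. discriminate.
Qed.

Lemma Fcyc_not_source {E : Egraph} x (w : gV (F (Fcyc E x))) : ~ source w.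
Proof. intros H. exact (H w eq_refl). Qed.

(** The pattern is that of [Finf_ERG], except that every core vertex has a core successor, given by
    [csucc], so no end of the core needs separate treatment. *)
Lemma Fcyc_ERG {E : Egraph} x : inXc E x -> is_ERG (Fcyc E x).
Proof.
  intros Hx.
  apply is_ERG_iff. split; [|split; [|split]].
  - intros [i|t]; (split; [|reflexivity]).
    + symmetry. apply step_rd_sd. exact (inXc_step x i Hx).
    + destruct (Tcyc_cases x t) as (i & a & l & H & ->).
      destruct (Fcyc_src_cases x i a l H) as [[-> ->]|(l' & b & H' & -> & ->)].
      * symmetry. apply (step_rd_sd (lab i) a). now apply inXcy_iff in H.
      * simpl. rewrite last_last. symmetry. apply step_rd_sd.
        destruct (proj1 (inXcy_iff _ _ _) H) as [Hs _]. now apply Sorted_snoc in Hs.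
  - intros f f' Hf. exact Hf.
  - intros w Hw. destruct (Fcyc_not_source _ _ Hw).
  - intros [i|t].
    + change (out_bij (Fcyc E x) (inl i) (step (lab i))).
      assert (Hin : forall f : gE (F (Fcyc E x)), gsrc f = inl i ->
        f = inl (csucc i) \/ exists H, f = inr (mkTcyc i (phiE (Fcyc E x) f) [] H)).
      { intros [j|t] Hs.
        - left. injection Hs as <-. now rewrite csucc_cpred.
        - right. destruct (Tcyc_cases x t) as (j & a & l & H & ->).
          destruct (Fcyc_src_cases x j a l H) as [[-> Hj]|(l' & b & H' & -> & Hj)];
            rewrite Hj in Hs; [|discriminate].
          injection Hs as ->. exists H. reflexivity. }
      split.
      * intros f1 f2 H1 H2 He.
        destruct (Hin f1 H1) as [->|(K1 & E1)], (Hin f2 H2) as [->|(K2 & E2)].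
        -- reflexivity.
        -- destruct (proj1 (inXcy_iff _ _ _) K2) as (_ & _ & K). destruct K. now rewrite <- He.
        -- destruct (proj1 (inXcy_iff _ _ _) K1) as (_ & _ & K). destruct K. now rewrite He.
        -- rewrite E1, E2. f_equal. apply mkTcyc_ext; auto.
      * intros d. split.
        -- intros Hd. destruct (classic (d = lab (csucc i))) as [->|Hi].
           ++ exists (inl (csucc i)). split; [|reflexivity].
              change (inl (cpred (csucc i)) = inl i :> gV (F (Fcyc E x))). now rewrite cpred_csucc.
           ++ assert (H : proj1_sig i < length x /\ inXcy E x (proj1_sig i) d [])
                by (apply inXcy_iff; auto).
              exists (inr (mkTcyc i d [] H)). split; [|reflexivity].
              destruct (Fcyc_src_cases x i d [] H) as [[_ Hj]|(l' & b & H' & Hl & _)]; [exact Hj|].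
              destruct l'; discriminate.
        -- intros (f & Hf & <-). destruct (Hin f Hf) as [->|(K & _)].
           ++ rewrite <- (cpred_csucc i) at 1. exact (inXc_step x (csucc i) Hx).
           ++ now apply inXcy_iff in K.
    + destruct (Tcyc_cases x t) as (i & a & l & H & ->).
      change (out_bij (Fcyc E x) (inr (mkTcyc i a l H)) (step (last l a))).
      assert (Hin : forall f : gE (F (Fcyc E x)), gsrc f = inr (mkTcyc i a l H) ->
        exists H, f = inr (mkTcyc i a (l ++ [phiE (Fcyc E x) f]) H)).
      { intros [j|t] Hs; [discriminate|]. destruct (Tcyc_cases x t) as (j & b & m & K & ->).
        destruct (Fcyc_src_cases x j b m K) as [[-> Hj]|(l' & c & H' & -> & Hj)];
          rewrite Hj in Hs; [discriminate|].
        injection Hs as Hji -> ->. apply sig_ext in Hji. subst j.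
        simpl. rewrite last_last. exists K. reflexivity. }
      split.
      * intros f1 f2 H1 H2 He. destruct (Hin f1 H1) as [K1 ->], (Hin f2 H2) as [K2 ->].
        f_equal. apply mkTcyc_ext; congruence.
      * intros d. split.
        -- intros Hd. assert (H' : proj1_sig i < length x /\ inXcy E x (proj1_sig i) a (l ++ [d])).
           { apply inXcy_iff. destruct (proj1 (inXcy_iff _ _ _) H). rewrite Sorted_snoc. auto. }
           exists (inr (mkTcyc i a (l ++ [d]) H')). split; [|apply last_last].
           destruct (Fcyc_src_cases x i a (l ++ [d]) H') as [[Hj _]|(l' & c & K & Hl & Hj)].
           ++ destruct l; discriminate.
           ++ rewrite Hj. apply app_inj_tail in Hl as [-> _]. f_equal. now apply mkTcyc_ext.
        -- intros (f & Hf & <-). destruct (Hin f Hf) as [K _].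
           apply inXcy_iff in K as [K _]. now apply Sorted_snoc in K.
Qed.

Lemma Fcyc_back_chain {E : Egraph} x (j : Idx E x) :
  back_chain (F (Fcyc E x)) (fun n => inl (Nat.iter n (@cpred E x) j)).
Proof. intros n. reflexivity. Qed.

Lemma iter_cpred {E : Egraph} x (j : Idx E x) n : n < length x ->
  proj1_sig (Nat.iter n (@cpred E x) j) =
  if n <=? proj1_sig j then proj1_sig j - n else proj1_sig j + length x - n.
Proof.
  destruct j as [j Hj]. simpl proj1_sig. induction n as [|n IH]; intros Hn; [simpl; lia|].
  change (proj1_sig (cpred (Nat.iter n (@cpred E x) (exist _ j Hj))) =
    if S n <=? j then j - S n else j + length x - S n).
  unfold cpred at 1. simpl proj1_sig. rewrite IH by lia.
  destruct (Nat.leb_spec n j), (Nat.leb_spec (S n) j).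
  - destruct (j - n) eqn:?; lia.
  - replace (j - n) with 0 by lia. lia.
  - lia.
  - destruct (j + length x - n) eqn:?; lia.
Qed.

(** Core edges are positions of [x] and not letters, so the period is the full length even when [x]
    is a proper power. *)
Lemma Fcyc_period {E : Egraph} x (j : Idx E x) :
  period (fun n => inl (Nat.iter n (@cpred E x) j) : gE (F (Fcyc E x))) (length x).
Proof.
  assert (Hj := proj2_sig j). simpl in Hj. split; [lia|]. split.
  (* [iter_cpred] stops short of a full turn, so the last step is taken by hand; the length is
     generalized to expose its predecessor. *)
  - assert (H : forall L, L = length x ->
      proj1_sig (Nat.iter L (@cpred E x) j) = proj1_sig j).
    { intros [|m] Hm; [lia|].
      change (proj1_sig (cpred (Nat.iter m (@cpred E x) j)) = proj1_sig j).
      unfold cpred at 1. simpl proj1_sig. rewrite iter_cpred by lia.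
      destruct (Nat.leb_spec m (proj1_sig j)).
      - replace (proj1_sig j - m) with 0 by lia. lia.
      - destruct (proj1_sig j + length x - m) eqn:?; lia. }
    f_equal. apply sig_ext. exact (H _ eq_refl).
  - intros n Hn H. injection H as H. apply (f_equal (@proj1_sig _ _)) in H.
    rewrite iter_cpred in H by lia. simpl in H.
    destruct (Nat.leb_spec n (proj1_sig j)); lia.
Qed.

(** Walking back from position [j] meets letter [j] first, so the word read forwards ends with that
    letter and begins with its successor. *)
Lemma Fcyc_cycle_word {E : Egraph} x (j : Idx E x) :
  cycle_word (Fcyc E x) (fun n => inl (Nat.iter n (@cpred E x) j))
    (skipn (S (proj1_sig j)) x ++ firstn (S (proj1_sig j)) x).
Proof.
  assert (Hj := proj2_sig j). simpl in Hj.
  assert (Hlen : length (skipn (S (proj1_sig j)) x ++ firstn (S (proj1_sig j)) x) = length x).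
  { rewrite length_app, length_skipn, length_firstn. lia. }
  unfold cycle_word. rewrite Hlen. split; [apply Fcyc_period|].
  apply (nth_ext _ _ (lab j) (lab j)).
  - rewrite length_rev, length_map, length_seq. exact Hlen.
  - rewrite Hlen. intros n Hn.
    rewrite rev_nth by (now rewrite length_map, length_seq).
    rewrite length_map, length_seq.
    rewrite (nth_indep (map _ _) _ (lab (Nat.iter 0 (@cpred E x) j)))
      by (rewrite length_map, length_seq; lia).
    rewrite (map_nth (fun n => lab (Nat.iter n (@cpred E x) j))), seq_nth by lia.
    rewrite (lab_nth (Nat.iter _ _ j) (lab j)), iter_cpred by lia.
    (* Letter [n] from the left is met after [length x - S n] steps back; whether the walk has
       passed position 0 by then decides which half of the rotation holds it. *)
    destruct (Nat.leb_spec (0 + (length x - S n)) (proj1_sig j)).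
    + rewrite app_nth2; rewrite length_skipn; [|lia].
      rewrite nth_firstn.
      destruct (Nat.ltb_spec (n - (length x - S (proj1_sig j))) (S (proj1_sig j))); [|lia].
      f_equal. lia.
    + rewrite app_nth1 by (rewrite length_skipn; lia). rewrite nth_skipn. f_equal. lia.
Qed.

Lemma Fcyc_core_connected {E : Egraph} x (i j : Idx E x) :
  clos_refl_trans _ (gadj (F (Fcyc E x))) (inl i) (inl j).
Proof.
  (* Both directions are carried through the induction because the closure is directed, while each
     core edge may be used either way. *)
  assert (H : forall n (k : Idx E x), n = proj1_sig k ->
    forall H0, clos_refl_trans _ (gadj (F (Fcyc E x))) (inl k) (inl (exist _ 0 H0))
      /\ clos_refl_trans _ (gadj (F (Fcyc E x))) (inl (exist _ 0 H0)) (inl k)).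
  { induction n as [|n IH]; intros k Hk H0.
    - replace k with (exist (fun i => i < length x) 0 H0) by now apply sig_ext.
      split; apply rt_refl.
    - destruct (IH (cpred k)) with (H0 := H0) as [H1 H2].
      { destruct k as [[|k] Hk']; simpl in *; lia. }
      split.
      + apply rt_trans with (inl (cpred k)); [|exact H1].
        apply rt_step. exists (inl k). right. split; reflexivity.
      + apply rt_trans with (inl (cpred k)); [exact H2|].
        apply rt_step. exists (inl k). left. split; reflexivity. }
  assert (H0 : 0 < length x) by (destruct i; lia).
  apply rt_trans with (inl (exist _ 0 H0)); eapply H; reflexivity.
Qed.

Lemma Fcyc_connected {E : Egraph} x : inXc E x -> erg_connected (Fcyc E x).
Proof.
  intros (Hx & _).
  assert (H0 : 0 < length x) by (destruct x; [contradiction|simpl; lia]).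
  apply (connected_to (Fcyc E x) (inl (exist _ 0 H0))).
  intros [i|t]; [apply Fcyc_core_connected|].
  destruct (Tcyc_cases x t) as (i & a & l & H & ->).
  induction l as [|b l IH] using rev_ind.
  - apply rt_trans with (inl i); [apply Fcyc_core_connected|].
    apply rt_step. exists (inr (mkTcyc i a [] H)). left. split; [|reflexivity].
    destruct (Fcyc_src_cases x i a [] H) as [[_ Hj]|(l' & c & H' & Hl & _)]; [exact Hj|].
    destruct l'; discriminate.
  - destruct (Fcyc_src_cases x i a (l ++ [b]) H) as [[Hl _]|(l' & c & H' & Hl & Hs)].
    + destruct l; discriminate.
    + apply app_inj_tail in Hl as [<- _].
      apply rt_trans with (inr (mkTcyc i a l H')); [apply IH|].
      apply rt_step. exists (inr (mkTcyc i a (l ++ [b]) H)). left. split; [exact Hs|reflexivity].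
Qed.

Lemma Fcyc_back_chain_core {E : Egraph} x c :
  back_chain (F (Fcyc E x)) c -> exists N j, forall k, c (k + N) = inl (Nat.iter k (@cpred E x) j).
Proof.
  intros Hc.
  assert (H : exists N j, c N = inl j).
  { destruct (c 0) as [i|t] eqn:H0; [eauto|].
    destruct (Tcyc_cases x t) as (i & a & l & H & ->).
    generalize 0 H0. clear H0. revert H. induction l as [|b l IH] using rev_ind; intros H n Hn.
    - destruct (Fcyc_src_cases x i a [] H) as [[_ Hs]|(l' & d & H' & Hl & _)];
        [|destruct l'; discriminate].
      exists (S n), i. rewrite <- (Hc n : _ = c (S n)), Hn. exact Hs.
    - destruct (Fcyc_src_cases x i a (l ++ [b]) H) as [[Hl _]|(l' & d & H' & Hl & Hs)].
      + destruct l; discriminate.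
      + apply app_inj_tail in Hl as [<- _]. apply (IH H' (S n)).
        rewrite <- (Hc n : _ = c (S n)), Hn. exact Hs. }
  destruct H as (N & j & H). exists N, j. induction k as [|k IH]; [exact H|].
  simpl. rewrite <- (Hc (k + N) : _ = c (S (k + N))), IH. reflexivity.
Qed.

Lemma Fcyc_cycle_word_unique {E : Egraph} x c y :
  inXc E x -> back_chain (F (Fcyc E x)) c -> cycle_word (Fcyc E x) c y -> sim_c E y x.
Proof.
  intros Hx Hc Hy. assert (HG := Fcyc_ERG x Hx).
  destruct (Fcyc_back_chain_core x c Hc) as (N & j & Hj).
  assert (Hcj : exists j, c 0 = inl j).
  (* The line lies in the core from index [N] on. The index [N * length y] is at least [N] and a
     multiple of the period, so [c 0] itself lies in the core. *)
  { destruct Hy as [Hp _]. exists (Nat.iter (N * length y - N) (@cpred E x) j). rewrite <- Hj.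
    assert (0 < length y) by apply Hp.
    rewrite (back_chain_mod _ c _ (N * length y - N + N) HG Hc Hp).
    replace (N * length y - N + N) with (N * length y) by nia.
    now rewrite Nat.Div0.mod_mul. }
  clear N j Hj. destruct Hcj as [j Hj].
  exists (S (proj1_sig j)). assert (Hlt := proj2_sig j). simpl in Hlt. split; [lia|].
  apply (cycle_word_unique (Fcyc E x) c); [exact Hy|].
  assert (Heq : forall n, c n = inl (Nat.iter n (@cpred E x) j)).
  { intros n. assert (H := back_chain_eq _ c _ 0 0 HG Hc (Fcyc_back_chain x j) Hj n).
    now rewrite !Nat.add_0_r in H. }
  destruct (Fcyc_cycle_word x j) as [(Hp & Hp0 & Hmin) Hw]. split.
  - split; [exact Hp|]. rewrite !Heq. split; [exact Hp0|]. intros n. rewrite Heq. apply Hmin.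
  - rewrite Hw at 1. f_equal. apply map_ext. intros n. now rewrite Heq.
Qed.

(** * Classification *)

Theorem theorem5p17 (E : Egraph)
  (HE : row_finite E) (Hsp : special_choice E)
  (R : (nat -> dedge (EE E)) -> Prop) (S : list (dedge (EE E)) -> Prop)
  (HR : complete_reps (@inXinf E) (@sim_inf E) R)
  (HS : complete_reps (@inXc E) (@sim_c E) S) :
  let adm (i : fidx E) : Prop :=
    match i with FVert _ _ => True | FInf _ x => R x | FCyc _ y => S y end in
  (* every member of the family is a nonempty connected extended representation graph *)
  (forall i, adm i -> is_ERG (Fam i) /\ erg_nonempty (Fam i) /\ erg_connected (Fam i)) /\
  (* every nonempty connected extended representation graph is isomorphic to a member *)
  (forall G : ergraph E, is_ERG G -> erg_nonempty G -> erg_connected G ->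
     exists i, adm i /\ erg_iso G (Fam i)) /\
  (* each isomorphism class is represented exactly once *)
  (forall i j, adm i -> adm j -> erg_iso (Fam i) (Fam j) -> i = j).
Proof.
  intros adm. destruct HR as (HR1 & HR2 & HR3), HS as (HS1 & HS2 & HS3).
  split; [|split].
  - intros [v|x|y] Ha; simpl in Ha |- *.
    + split; [apply Fv_ERG|]. split; [|apply Fv_connected].
      constructor. exists []. now left.
    + split; [now apply Finf_ERG, HR1|]. split; [|apply Finf_connected].
      constructor. exact (inl 0).
    + apply HS1 in Ha. split; [now apply Fcyc_ERG|]. split; [|now apply Fcyc_connected].
      constructor. left. exists 0. destruct Ha as [Ha _].
      destruct y; [contradiction|simpl; lia].
  - intros G HG [u] GC.
    destruct (classic (exists w : gV (F G), source w)) as [[w Hw]|Hns].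
    + exists (FVert E (phiV G w)). split; [exact I|].
      assert (H0 : inXv E (phiV G w) []) by now left.
      apply (iso_of_source w (exist _ [] H0 : gV (F (Fv E (phiV G w)))));
        auto using Fv_ERG, Fv_connected.
      now apply Fv_source.
    + assert (Hns' : forall w : gV (F G), ~ source w) by eauto.
      destruct (source_or_edge u) as [Hu|[f _]]; [destruct (Hns' u Hu)|].
      destruct (back_chain_exists (F G) f Hns') as (c & Hc & _).
      destruct (classic (forall n k, c n = c k -> n = k)) as [Hinj|Hper].
      * destruct (HR2 (fun n => phiE G (c n))) as (z & Hz & m & n & Hmn).
        { apply inXinf_iff. intros n. now apply back_chain_step. }
        exists (FInf E z). split; [exact Hz|].
        (* Both lines are cut where their labels begin to agree; both cores are injective, so their
           repetition patterns agree trivially. *)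
        apply (iso_of_back_chains (fun k => c (m + k))
                 (fun k => inl (n + k) : gE (F (Finf E z)))); auto.
        -- apply Finf_ERG; auto.
        -- apply Finf_connected.
        -- intros k. rewrite Nat.add_succ_r. apply Hc.
        -- intros k. now rewrite Nat.add_succ_r.
        -- intros i j. split.
           ++ intros Hij. apply Hinj in Hij. f_equal. lia.
           ++ intros Hij. injection Hij as Hij. f_equal. lia.
      * assert (Hp : exists n k, n < k /\ c k = c n).
        { apply NNPP. intros Hno. apply Hper. intros n k Hnk.
          destruct (lt_eq_lt_dec n k) as [[H|H]|H]; auto; destruct Hno; eauto. }
        destruct Hp as (n & k & Hnk & Hcnk).
        (* The line is restarted at a repeated edge, so that it returns to its own first edge. *)
        assert (Hc' : back_chain (F G) (fun i => c (i + n))) by (intros i; apply Hc).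
        destruct (period_exists (fun i => c (i + n)) (k - n)) as [p Hp]; [lia| |].
        { rewrite <- Hcnk at 1. simpl. f_equal. lia. }
        assert (Hw := cycle_word_exists G _ p Hp).
        destruct (HS2 _ (cycle_word_inXc G _ _ HG Hc' Hw)) as (z & Hz & q & Hq & Hqz).
        exists (FCyc E z). split; [exact Hz|].
        (* Starting at position [q - 1] makes the cycle of [z] spell its rotation by [q], which is
           the word found in [G]. *)
        assert (Hq' : q - 1 < length z) by lia.
        assert (Hzw := Fcyc_cycle_word z (exist _ (q - 1) Hq')). simpl proj1_sig in Hzw.
        replace (Datatypes.S (q - 1)) with q in Hzw by lia. rewrite <- Hqz in Hzw.
        apply HS1 in Hz.
        apply (iso_of_cycle_words _ _ _ HG (Fcyc_ERG z Hz) GC (Fcyc_connected z Hz) Hc'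
                 (Fcyc_back_chain z _) Hw Hzw).
  (* A line that returns to its first edge would be carried into a graph where no line repeats. *)
  - assert (Hmixed : forall x y, R x -> S y -> ~ erg_iso (Fcyc E y) (Finf E x)).
    { intros x y Hx Hy Hi. apply HS1 in Hy. assert (Hlen : 0 < length y).
      { destruct Hy as [Hy _]. destruct y; [contradiction|simpl; lia]. }
      destruct (iso_cycle_word _ _ _ _ Hi (Fcyc_back_chain y (exist _ 0 Hlen))
                  (Fcyc_cycle_word y _)) as (d & Hd & ((Hp & Hd0 & _) & _)).
      apply (Finf_back_chain_inj x d _ _ (HR1 x Hx) Hd) in Hd0. lia. }
    assert (Hsource : forall v (H : ergraph E), erg_iso (Fv E v) H ->
              exists w : gV (F H), source w /\ phiV H w = v).
    { intros v H Hi. assert (H0 : inXv E v []) by now left.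
      destruct (iso_source _ _ (exist _ [] H0 : gV (F (Fv E v))) Hi) as (w & Hw & He).
      - now apply Fv_source.
      - exists w. split; [exact Hw|exact He]. }
    intros [v|x|y] [v'|x'|y'] Hi Hj Hiso; simpl in Hi, Hj, Hiso.
    + destruct (Hsource v _ Hiso) as (w & Hw & He). apply Fv_source in Hw.
      destruct w as [w Hw']. simpl in Hw. subst w. simpl in He. now subst.
    + destruct (Hsource v _ Hiso) as (w & Hw & _). destruct (Finf_not_source _ _ Hw).
    + destruct (Hsource v _ Hiso) as (w & Hw & _). destruct (Fcyc_not_source _ _ Hw).
    + destruct (Hsource v' _ (iso_sym _ _ Hiso)) as (w & Hw & _).
      destruct (Finf_not_source _ _ Hw).
    + f_equal. apply HR3; auto.
      destruct (iso_back_chain _ _ _ Hiso (Finf_back_chain x)) as (d & Hd & Hl & _).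
      destruct (Finf_back_chain_core x' d Hd) as (N & M & HNM).
      exists N, M. intros k. specialize (Hl (N + k)). rewrite HNM in Hl. symmetry. exact Hl.
    + destruct (Hmixed x y'); auto. now apply iso_sym.
    + destruct (Hsource v' _ (iso_sym _ _ Hiso)) as (w & Hw & _).
      destruct (Fcyc_not_source _ _ Hw).
    + destruct (Hmixed x' y); auto.
    + f_equal. apply HS3; auto.
      assert (Hy := HS1 y Hi). assert (Hlen : length y - 1 < length y).
      (* Starting from the last position gives the trivial rotation, so the line spells [y]
         itself. *)
      { destruct Hy as [Hy _]. destruct y; [contradiction|simpl; lia]. }
      assert (Hw := Fcyc_cycle_word y (exist _ (length y - 1) Hlen)). simpl proj1_sig in Hw.
      replace (Datatypes.S (length y - 1)) with (length y) in Hw by lia.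
      rewrite skipn_all, firstn_all in Hw.
      destruct (iso_cycle_word _ _ _ _ Hiso (Fcyc_back_chain y _) Hw) as (d & Hd & Hdw).
      apply (Fcyc_cycle_word_unique y' d y); auto.
Qed.
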